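(* Let $p$ be a prime and let $S$ be the set of all formal power series of the form $$t+\sum_{k\ge 1}\left(a_{pk}t^{pk}+a_{pk+1}t^{pk+1}\right),\qquad a_{pk},a_{pk+1}\in\mathbb F_p,$$ that is, $S=\{t+\sum_{\lambda\in B}a_\lambda t^{\lambda+1}: a_\lambda\in\mathbb F_p\}$ with $B=p\mathbb N\cup(p\mathbb N-1)$, a closed subgroup of the Nottingham group $\mathcal J$ over $\mathbb F_p$. Then $S$ is a hereditarily just infinite pro-$p$ group, and $S$ contains non-trivial elements of finite order.
   Context: The Nottingham group $\mathcal J$ over $\mathbb F_p$ is the group $\{t+\sum_{k\ge1}a_kt^{k+1}: a_k\in\mathbb F_p\}$ of formal power series under substitution (composition), $(f\circ g)(t)=f(g(t))$; it is a pro-$p$ group with the topology in which the subgroups $\{f: f\equiv t \bmod t^{n}\}$ form a base of open neighbourhoods of the identity $t$. A pro-$p$ group $G$ is hereditarily just infinite if it is infinite and every non-trivial closed normal subgroup of every open subgroup of $G$ is open. *)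

(* Defs.v *)
From mathcomp Require Import all_boot all_algebra.
Set Implicit Arguments. Unset Strict Implicit. Unset Printing Implicit Defensive.
Import GRing.Theory.
Local Open Scope ring_scope.

(** Formal power series over F_p, as coefficient sequences: f = sum_i f i t^i. *)
Definition series (p : nat) := nat -> 'F_p.

Definition trunc (p n : nat) (f : series p) : {poly 'F_p} := \poly_(i < n) f i.

(** Substitution (f o g)(t) = f(g(t)); for g with zero constant term, the
    n-th coefficient only depends on f, g mod t^(n+1). *)
Definition scomp (p : nat) (f g : series p) : series p :=
  fun n => ((trunc n.+1 f) \Po (trunc n.+1 g))`_n.

Definition sid (p : nat) : series p := fun n => if n == 1%N then 1 else 0.

Definition agree (p n : nat) (f g : series p) : Prop :=
  forall i, (i < n)%N -> f i = g i.

Definition Nottingham (p : nat) (f : series p) : Prop := f 0%N = 0 /\ f 1%N = 1.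

Definition S_set (p : nat) (f : series p) : Prop :=
  Nottingham f /\
  forall i, (1 < i)%N -> ~~ ((p %| i) || (p %| i.-1))%N -> f i = 0.

Definition subset_of (p : nat) (A B : series p -> Prop) := forall f, A f -> B f.

Definition subgroup (p : nat) (G A : series p -> Prop) : Prop :=
  subset_of A G /\ A (sid p) /\
  (forall f g, A f -> A g -> A (scomp f g)) /\
  (forall f, A f -> exists g, A g /\ scomp f g = sid p).

Definition normal_subgroup (p : nat) (H N : series p -> Prop) : Prop :=
  subgroup H N /\
  forall h n, H h -> N n -> exists n', N n' /\ scomp n h = scomp h n'.

(** Topology of J: the subgroups {f : f = t mod t^n} form a base of
    neighbourhoods of t, i.e. the basic open sets around x are
    {y : y = x mod t^n}.  Relative openness / closedness in A: *)
Definition open_in (p : nat) (A B : series p -> Prop) : Prop :=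
  subset_of B A /\
  forall x, B x -> exists n, forall y, A y -> agree n x y -> B y.

Definition closed_in (p : nat) (A B : series p -> Prop) : Prop :=
  subset_of B A /\
  forall f, A f -> (forall n, exists g, B g /\ agree n f g) -> B f.

Definition in_coset (p : nat) (N : series p -> Prop) (x y : series p) : Prop :=
  exists n, N n /\ scomp x n = y.

Definition index_is (p : nat) (H N : series p -> Prop) (m : nat) : Prop :=
  exists r : 'I_m -> series p,
    (forall i, H (r i)) /\
    (forall i j, in_coset N (r i) (r j) -> i = j) /\
    (forall h, H h -> exists i, in_coset N (r i) h).

(** G is a pro-p group (as a subgroup of J with the induced topology):
    a closed subgroup of the (compact, Hausdorff, totally disconnected)
    group J, all of whose open normal subgroups have p-power index. *)
Definition pro_p_subgroup (p : nat) (G : series p -> Prop) : Prop :=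
  subgroup (@Nottingham p) G /\ closed_in (@Nottingham p) G /\
  forall N, normal_subgroup G N -> open_in G N ->
    exists e, index_is G N (p ^ e)%N.

Definition infinite_set (p : nat) (G : series p -> Prop) : Prop :=
  forall (m : nat) (r : 'I_m -> series p), exists f, G f /\ forall i, f <> r i.

Definition hereditarily_just_infinite (p : nat) (G : series p -> Prop) : Prop :=
  infinite_set G /\
  forall H, subgroup G H -> open_in G H ->
  forall N, normal_subgroup H N -> closed_in H N ->
    (exists n, N n /\ n <> sid p) -> open_in H N.

(* Main.v *)
Require Import Defs.
From mathcomp Require Import all_boot all_algebra finfield.
From mathcomp Require Import ring zify.
From Stdlib Require Import Classical FunctionalExtensionality.
Set Implicit Arguments. Unset Strict Implicit. Unset Printing Implicit Defensive.
Import GRing.Theory.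
Local Open Scope ring_scope.

(** Every [f] in [S] is uniquely [A(t^p) + t B(t^p)] with [A(0) = 0] and
    [B(0) = 1].  Since [g(t)^p = g(t^p)] over [F_p], composition of such pairs is
    [(A, B) o (a, b) = (A o g + a (B o g), b (B o g))] where [g] denotes
    [a(t^p) + t b(t^p)]; in particular [S] is closed under composition.

    Let [N] be a non-trivial closed normal subgroup of an open subgroup.  Take
    [f = t + phi t^q + ...] in [N], with first part [A = alpha t^k + ...], and
    [g] with parts [(0, 1 + c t^l)], [l] large.  The commutator of [f] and [g]
    has parts
      [A = - c alpha t^(k+l) + ...],  [B = 1 - c l phi t^(l+q-1) + ...].
    Iterating this twice yields, for each [D] and all large [m], elements of [N]
    whose [A] starts with any prescribed [c t^m] while [B = 1 mod t^(m+D)].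
    These serve to clear the [A] part of an element without disturbing its [B]
    part up to a given order.  Clearing the commutators above with [q = p k]
    (leading term of [f] in [A]) gives elements with [B = 1 + c t^e + ...] for
    all large [e] with [p] not dividing [e + 1]; with [q = p j + 1] (leading
    term of [f] in [B]) it gives those with [p] not dividing [e].  So [N] has
    elements with every large leading term available in [S], and is open since
    it is closed.

    For torsion, the series with [f^(1-p) = t^(1-p) + 1] lies in [S], and its
    [m]-th iterate satisfies [f^(1-p) = t^(1-p) + m]. *)

(** * X-adic estimates for composition of polynomials *)

Section PolyXadic.
Variable F : fieldType.
Implicit Types (u v w A g h : {poly F}) (a b c : F).

Lemma dvdXnP n u :
  reflect (forall i, (i < n)%N -> u`_i = 0) ('X^n %| u).
Proof.
apply: (iffP idP) => [/dvdpP [w ->] i lt_in|u0]; first by rewrite coefMXn lt_in.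
rewrite -[u](poly_take_drop n); suff -> : take_poly n u = 0.
  by rewrite add0r dvdp_mull.
by apply/polyP => i; rewrite coef_take_poly coef0; case: ifP => // /u0.
Qed.

Lemma dvdXn_leq m n u : (m <= n)%N -> 'X^n %| u -> 'X^m %| u.
Proof. by move=> le_mn; apply: dvdp_trans; apply: dvdp_exp2l. Qed.

Lemma dvdXn_mul m n u v : 'X^m %| u -> 'X^n %| v -> 'X^(m + n) %| u * v.
Proof. by rewrite exprD; apply: dvdp_mul. Qed.

Lemma dvdXn_exp n u : 'X %| u -> 'X^n %| u ^+ n.
Proof. exact: dvdp_exp2r. Qed.

Lemma dvdX_coef0 u : ('X %| u) = (u`_0 == 0).
Proof.
rewrite -['X]expr1; apply/dvdXnP/eqP => [-> //|u0 i].
by rewrite ltnS leqn0 => /eqP ->.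
Qed.

Lemma dvdp_comb (d x y z w : {poly F}) : d %| x -> d %| y -> d %| z * x + w * y.
Proof. by move=> dx dy; rewrite dvdp_add ?dvdp_mull. Qed.

Lemma dvdX_sub1_coprime n v : 'X %| v - 1 -> coprimep 'X^n v.
Proof.
rewrite dvdX_coef0 coefB coef1 subr_eq0 => /eqP v0.
apply: coprimep_expl; rewrite coprimep_sym coprimepX /root horner_coef0 v0.
exact: oner_neq0.
Qed.

Lemma dvdX_comp u v : 'X %| u -> 'X %| v -> 'X %| (u \Po v).
Proof.
case/dvdpP=> w ->; rewrite comp_polyM comp_polyX => Xv.
exact: dvdp_mull.
Qed.

Lemma dvdXn_comp n u v : 'X^n %| u -> 'X %| v -> 'X^n %| (u \Po v).
Proof.
case/dvdpP=> w ->; rewrite comp_polyM comp_Xn_poly => Xv.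
by rewrite dvdp_mull // dvdXn_exp.
Qed.

Lemma dvdp_sub_comp u g h : (g - h) %| ((u \Po g) - (u \Po h)).
Proof.
elim/poly_ind: u => [|u c IH]; first by rewrite !comp_poly0 subrr dvdp0.
rewrite !comp_poly_MXaddC.
have -> : (u \Po g) * g + c%:P - ((u \Po h) * h + c%:P) =
  g * ((u \Po g) - (u \Po h)) + (u \Po h) * (g - h) by ring.
exact: dvdp_comb.
Qed.

(** Telescoping writes the difference as [g - h] times products of k - 1 factors taken from [g] and
    [h], each divisible by X. *)
Lemma dvdXn_sub_exp n k g h : 'X %| g -> 'X %| h -> 'X^(n.+1) %| g - h ->
  'X^(n + k) %| g ^+ k - h ^+ k.
Proof.
move=> Xg Xh Xgh; elim: k => [|k IH]; first by rewrite !expr0 subrr dvdp0.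
have -> : g ^+ k.+1 - h ^+ k.+1 = g * (g ^+ k - h ^+ k) + (g - h) * h ^+ k.
  by rewrite !exprS; ring.
apply: dvdp_add; first by rewrite addnS -add1n dvdXn_mul // expr1.
by rewrite addnS -addSn dvdXn_mul // dvdXn_exp.
Qed.

(** The order of vanishing of [A] improves the plain bound [dvdp_sub_comp]. With [h] = X it controls
    how little [A] changes under a substitution close to the identity. *)
Lemma dvdXn_sub_comp n k A g h : 'X^k %| A -> 'X %| g -> 'X %| h ->
  'X^(n.+1) %| g - h -> 'X^(n + k) %| (A \Po g) - (A \Po h).
Proof.
case/dvdpP=> w -> Xg Xh Xgh; rewrite !comp_polyM !comp_Xn_poly.
set W := (w \Po _); set V := (w \Po _).
have -> : W * g ^+ k - V * h ^+ k = g ^+ k * (W - V) + V * (g ^+ k - h ^+ k).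
  by ring.
apply: dvdp_add; last by rewrite dvdp_mull // dvdXn_sub_exp.
rewrite addnC dvdXn_mul ?dvdXn_exp //.
apply: dvdp_trans (dvdp_sub_comp w g h).
exact: dvdXn_leq Xgh.
Qed.

Lemma dvdXn_comp_congr n u u' v v' : 'X %| v -> 'X %| v' ->
  'X^n %| u - u' -> 'X^n %| v - v' -> 'X^n %| (u \Po v) - (u' \Po v').
Proof.
move=> Xv Xv' uu' vv'.
have -> : (u \Po v) - (u' \Po v') = ((u - u') \Po v) + ((u' \Po v) - (u' \Po v')).
  by rewrite comp_polyB; ring.
apply: dvdp_add; first exact: dvdXn_comp.
exact: dvdp_trans vv' (dvdp_sub_comp u' v v').
Qed.

(** [dvdXn_sub_comp] applied to [u - 'X], of order at least 2, gains one order: the leading term of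
    [v - v'] passes through [u] unchanged. *)
Lemma dvdXn_tangent_comp n u v v' : 'X^2 %| u - 'X -> 'X %| v -> 'X %| v' ->
  'X^(n.+1) %| v - v' -> 'X^(n.+2) %| ((u \Po v) - (u \Po v')) - (v - v').
Proof.
move=> u2 Xv Xv' vv'.
have -> : ((u \Po v) - (u \Po v')) - (v - v') = ((u - 'X) \Po v) - ((u - 'X) \Po v').
  by rewrite !comp_polyB !comp_polyX; ring.
by rewrite -addn2 dvdXn_sub_comp.
Qed.

Lemma dvdXn_comp_cancel n u v v' : 'X^2 %| u - 'X -> 'X %| v -> 'X %| v' ->
  'X^n %| (u \Po v) - (u \Po v') -> 'X^n %| v - v'.
Proof.
move=> u2 Xv Xv'; elim: n => [|[|n] IH] uv; first by rewrite dvd1p.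
  by rewrite expr1 dvdp_sub.
have vv' := IH (dvdXn_leq (leqnSn _) uv).
have -> : v - v' = ((u \Po v) - (u \Po v')) - ((u \Po v) - (u \Po v') - (v - v')) by ring.
by rewrite dvdp_sub // dvdXn_tangent_comp.
Qed.

(** Later used to divide leading terms by second parts, which have constant term 1. *)
Lemma dvdXn_lead_quot n u v c : 'X %| v - 1 ->
  'X^(n.+1) %| u * v - c%:P * 'X^n -> 'X^(n.+1) %| u - c%:P * 'X^n.
Proof.
move=> v1 uv; rewrite -(@Gauss_dvdpl _ _ v) ?dvdX_sub1_coprime //.
have -> : (u - c%:P * 'X^n) * v =
  (u * v - c%:P * 'X^n) - c%:P * ('X^n * (v - 1)) by ring.
apply: dvdp_sub => //; apply: dvdp_mull.
by rewrite exprSr dvdp_mul.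
Qed.

(** The first two terms of a binomial expansion; they are the source of the factor l in the
    commutator formula. *)
Lemma dvdXn_exp_lead q f l c : 'X^(q.+3) %| f - 'X - c%:P * 'X^(q.+2) ->
  'X^((l + q).+2) %| f ^+ l - 'X^l - (l%:R * c)%:P * 'X^((l + q).+1).
Proof.
move=> f_q; elim: l => [|l IH]; first by
  rewrite !expr0 subrr mul0r polyC0 mul0r subr0 dvdp0.
have Xf : 'X %| f.
  have -> : f = (f - 'X - c%:P * 'X^(q.+2)) + 'X * (1 + c%:P * 'X^(q.+1)).
    by rewrite !exprS; ring.
  by rewrite dvdp_add ?dvdp_mulr //; apply: (@dvdXn_leq 1 _ _ _ f_q).
have fX : 'X^(q.+2) %| f - 'X.
  have -> : f - 'X = (f - 'X - c%:P * 'X^(q.+2)) + c%:P * 'X^(q.+2) by ring.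
  by apply: dvdp_add; [apply: dvdXn_leq f_q | rewrite dvdp_mull].
have -> : f ^+ l.+1 - 'X^(l.+1) - (l.+1%:R * c)%:P * 'X^((l.+1 + q).+1) =
  f * (f ^+ l - 'X^l - (l%:R * c)%:P * 'X^((l + q).+1))
  + (('X^l * (f - 'X - c%:P * 'X^(q.+2)))
  + (l%:R * c)%:P * ('X^((l + q).+1) * (f - 'X))).
  rewrite -addn1 natrD mulrDl mul1r polyCD !(exprS, exprD, exprMn); ring.
apply: dvdp_add; first by rewrite exprS dvdp_mul.
apply: dvdp_add.
  by apply: dvdXn_leq (dvdXn_mul (dvdpp _) f_q); lia.
apply: dvdp_mull.
by apply: dvdXn_leq (dvdXn_mul (dvdpp _) fX); lia.
Qed.

End PolyXadic.

(** * Substitution of series through polynomial representatives *)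

Section SeriesComposition.
Variable p : nat.
Implicit Types (f g h x : series p) (u v w : {poly 'F_p}).

(** Any representative modulo X^n is allowed, not only [trunc], so that polynomials of a convenient
    shape such as [emb a b] can be used. *)
Definition approx n f u := forall i, (i < n)%N -> f i = u`_i.

Lemma approx_trunc n f : approx n f (trunc n f).
Proof. by move=> i lt_in; rewrite coef_poly lt_in. Qed.

Lemma approx_leq m n f u : (m <= n)%N -> approx n f u -> approx m f u.
Proof. by move=> le_mn fu i lt_im; apply: fu; apply: leq_trans lt_im le_mn. Qed.

Lemma approx_agreeP n f g u v : approx n f u -> approx n g v ->
  (agree n f g <-> 'X^n %| u - v).
Proof.
move=> fu gv; split=> [fg|/dvdXnP uv i lt_in].
  by apply/dvdXnP => i lt_in; rewrite coefB -fu // -gv // fg // subrr.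
by apply/eqP; rewrite fu // gv // -subr_eq0 -coefB uv.
Qed.

Lemma approx_dvd n f u v : approx n f u -> approx n f v -> 'X^n %| u - v.
Proof. by move=> fu fv; apply/(approx_agreeP fu fv). Qed.

Lemma approx_dvdX n f u : (0 < n)%N -> f 0%N = 0 -> approx n f u -> 'X %| u.
Proof. by move=> n0 f0 fu; rewrite dvdX_coef0 -fu // f0. Qed.

Lemma approx_Nottingham n f u :
  (1 < n)%N -> Nottingham f -> approx n f u -> 'X^2 %| u - 'X.
Proof.
move=> n1 [f0 f1] fu; have [u0 u1] := (fu 0%N (ltnW n1), fu 1%N n1).
by apply/dvdXnP => -[|[|//]] _; rewrite coefB coefX -?u0 -?u1 ?f0 ?f1 subrr.
Qed.

Lemma approx_sid n : approx n (sid p) 'X.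
Proof. by move=> i _; rewrite coefX /sid; case: eqP. Qed.

(** Each coefficient of [scomp] has its own truncations. Composition respects congruence modulo each
    X^(i+1), so one pair of representatives serves them all. *)
Lemma scomp_approx n f g u v : g 0%N = 0 -> approx n f u -> approx n g v ->
  approx n (scomp f g) (u \Po v).
Proof.
move=> g0 fu gv i lt_in; apply/eqP; rewrite -subr_eq0 -coefB; apply/eqP.
apply: (dvdXnP i.+1 _ _) => //.
have [fi gi] := (approx_leq lt_in fu, approx_leq lt_in gv).
apply: dvdXn_comp_congr.
- exact: (approx_dvdX _ g0 (@approx_trunc i.+1 g)).
- exact: approx_dvdX gi.
- exact: approx_dvd (@approx_trunc _ _) fi.
- exact: approx_dvd (@approx_trunc _ _) gi.
Qed.

Lemma series_eq f g : (forall n, agree n f g) -> f = g.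
Proof. by move=> fg; apply: functional_extensionality => n; apply: (fg n.+1). Qed.

Lemma scomp0 f g : f 0%N = 0 -> g 0%N = 0 -> scomp f g 0%N = 0.
Proof.
move=> f0 g0.
rewrite (scomp_approx g0 (@approx_trunc 1 f) (@approx_trunc 1 g)) //.
apply/eqP; rewrite -dvdX_coef0.
by apply: dvdX_comp; apply: approx_dvdX (@approx_trunc _ _).
Qed.

Lemma scompA f g h : g 0%N = 0 -> h 0%N = 0 ->
  scomp (scomp f g) h = scomp f (scomp g h).
Proof.
move=> g0 h0; apply: series_eq => n.
have fn := @approx_trunc n f; have gn := @approx_trunc n g.
have hn := @approx_trunc n h.
apply/(approx_agreeP (scomp_approx h0 (scomp_approx g0 fn gn) hn)
  (scomp_approx (scomp0 g0 h0) fn (scomp_approx h0 gn hn))).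
by rewrite comp_polyA subrr dvdp0.
Qed.

Lemma scomp_idl f : f 0%N = 0 -> scomp (sid p) f = f.
Proof.
move=> f0; apply: series_eq => n; have fn := @approx_trunc n f.
apply/(approx_agreeP (scomp_approx f0 (@approx_sid n) fn) fn).
by rewrite comp_polyX subrr dvdp0.
Qed.

Lemma scomp_idr f : scomp f (sid p) = f.
Proof.
apply: series_eq => n; have fn := @approx_trunc n f.
apply/(approx_agreeP (scomp_approx _ fn (@approx_sid n)) fn) => //.
by rewrite comp_polyXr subrr dvdp0.
Qed.

Lemma agree_scomp n f f' g g' : g 0%N = 0 -> g' 0%N = 0 ->
  agree n f f' -> agree n g g' -> agree n (scomp f g) (scomp f' g').
Proof.
case: n => [|n] g0 g'0 ff' gg' //.
have [fn f'n] := (@approx_trunc n.+1 f, @approx_trunc n.+1 f').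
have [gn g'n] := (@approx_trunc n.+1 g, @approx_trunc n.+1 g').
apply/(approx_agreeP (scomp_approx g0 fn gn) (scomp_approx g'0 f'n g'n)).
apply: dvdXn_comp_congr.
- exact: approx_dvdX gn.
- exact: approx_dvdX g'n.
- exact/(approx_agreeP fn f'n).
- exact/(approx_agreeP gn g'n).
Qed.

Lemma agree_scomp_cancel n x f g : Nottingham x -> f 0%N = 0 -> g 0%N = 0 ->
  agree n (scomp x f) (scomp x g) -> agree n f g.
Proof.
case: n => [|[|n]] Nx f0 g0 fg //; first by case=> // _; rewrite f0 g0.
have [fn gn] := (@approx_trunc n.+2 f, @approx_trunc n.+2 g).
have xn := @approx_trunc n.+2 x.
apply/(approx_agreeP fn gn); apply: (@dvdXn_comp_cancel _ _ (trunc n.+2 x)).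
- exact: approx_Nottingham xn.
- exact: approx_dvdX fn.
- exact: approx_dvdX gn.
- exact/(approx_agreeP (scomp_approx f0 xn fn) (scomp_approx g0 xn gn)).
Qed.

Lemma scomp_cancel x f g : Nottingham x -> f 0%N = 0 -> g 0%N = 0 ->
  scomp x f = scomp x g -> f = g.
Proof.
move=> Nx f0 g0 fg; apply: series_eq => n.
by apply: (agree_scomp_cancel Nx) => //; rewrite fg.
Qed.

(** The first discrepancy of the inner series survives a substitution into a series tangent to the
    identity; this allows solving for an inverse one coefficient at a time. *)
Lemma scomp_next_coef n x f g : (0 < n)%N ->
  Nottingham x -> f 0%N = 0 -> g 0%N = 0 -> agree n f g ->
  scomp x f n - scomp x g n = f n - g n.
Proof.
case: n => // n _ Nx f0 g0 fg.
have [fn gn] := (@approx_trunc n.+2 f, @approx_trunc n.+2 g).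
have xn := @approx_trunc n.+2 x.
rewrite (scomp_approx f0 xn fn) // (scomp_approx g0 xn gn) //.
rewrite [f _]fn // [g _]gn //.
apply/eqP; rewrite -subr_eq0 -!coefB; apply/eqP.
apply: (dvdXnP n.+2 _ _) => //; apply: dvdXn_tangent_comp.
- exact: approx_Nottingham xn.
- exact: approx_dvdX fn.
- exact: approx_dvdX gn.
- by apply/(approx_agreeP (approx_leq (leqnSn _) fn) (approx_leq (leqnSn _) gn)).
Qed.

Lemma agree_sym n f g : agree n f g -> agree n g f.
Proof. by move=> fg i lt_in; rewrite fg. Qed.

Lemma agree_trans n f g h : agree n f g -> agree n g h -> agree n f h.
Proof. by move=> fg gh i lt_in; rewrite fg // gh. Qed.

Lemma agree_leq m n f g : (m <= n)%N -> agree n f g -> agree m f g.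
Proof. by move=> le_mn fg i lt_im; apply: fg; apply: leq_trans lt_im le_mn. Qed.

Lemma agreeS n f g : agree n f g -> f n = g n -> agree n.+1 f g.
Proof.
by move=> fg fgn i; rewrite ltnS leq_eqVlt => /orP [/eqP ->|/fg].
Qed.

Lemma sid0 : sid p 0%N = 0. Proof. by []. Qed.

Lemma agree_sid_Nottingham n f : (1 < n)%N -> agree n f (sid p) -> Nottingham f.
Proof. by move=> n1 fn; split; rewrite fn // (leq_trans _ n1). Qed.

Lemma Nottingham_agree2 f : Nottingham f -> agree 2 f (sid p).
Proof. by case=> f0 f1 [|[|]]. Qed.

Lemma agree_sid_scomp n f g : g 0%N = 0 ->
  agree n f (sid p) -> agree n g (sid p) -> agree n (scomp f g) (sid p).
Proof. by move=> g0 fn gn; rewrite -[sid p]scomp_idr; apply: agree_scomp. Qed.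

Lemma Nottingham_scomp f g : Nottingham f -> Nottingham g ->
  Nottingham (scomp f g).
Proof.
move=> Nf Ng; apply: (@agree_sid_Nottingham 2) => //.
by apply: agree_sid_scomp; [case: Ng | apply: Nottingham_agree2..].
Qed.

Lemma scomp_lead n f g : (1 < n)%N -> Nottingham f -> agree n g (sid p) ->
  scomp f g n = f n + g n.
Proof.
move=> n1 Nf gn; have [g0 _] := agree_sid_Nottingham n1 gn.
have := scomp_next_coef (ltnW n1) Nf g0 sid0 gn.
have sn : sid p n = 0 by rewrite /sid gtn_eqF.
rewrite scomp_idr sn subr0 => /eqP.
by rewrite subr_eq addrC => /eqP.
Qed.

End SeriesComposition.

(** * The two parts of an element of S and their leading terms *)

Section Decomposition.
Variable p : nat.
Hypothesis p_prime : prime p.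
Implicit Types (f g h x : series p) (a b A B u v w : {poly 'F_p}) (c d : 'F_p).

Let p_gt1 : (1 < p)%N := prime_gt1 p_prime.
Let p_gt0 : (0 < p)%N := prime_gt0 p_prime.

(** The coefficients lie in the prime field, so the p-th power map fixes them. *)
Lemma poly_frobenius u : u ^+ p = (u \Po 'X^p).
Proof.
elim/poly_ind: u => [|u c IH]; first by rewrite comp_poly0 expr0n gtn_eqF.
have cp : p \in [pchar {poly 'F_p}] by rewrite pchar_poly pchar_Fp.
rewrite exprDn_pchar ?pnatE // exprMn IH comp_poly_MXaddC; congr (_ + _).
by rewrite -polyC_exp; have := expf_card c; rewrite card_Fp // => ->.
Qed.

Definition emb a b := (a \Po 'X^p) + 'X * (b \Po 'X^p).

Lemma emb_comp A B a b : (emb A B \Po emb a b) =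
  emb ((A \Po emb a b) + a * (B \Po emb a b)) (b * (B \Po emb a b)).
Proof.
set g := emb a b.
(* As g^p = g(t^p), substituting g into u(t^p) gives (u o g)(t^p). *)
have gE u : ((u \Po 'X^p) \Po g) = ((u \Po g) \Po 'X^p).
  by rewrite -!comp_polyA comp_Xn_poly (poly_frobenius g).
rewrite {1}/emb comp_polyD comp_polyM comp_polyX !gE {2}/g /emb.
by rewrite !comp_polyD !comp_polyM; ring.
Qed.

Lemma dvdn_p_succ i : (p %| (p * i).+1)%N = false.
Proof. by rewrite -addn1 dvdn_addr ?dvdn_mulr // dvdn1 gtn_eqF. Qed.

Lemma coef_emb0 a b i : (emb a b)`_(p * i) = a`_i.
Proof.
rewrite coefD coefXM !coef_comp_poly_Xn // dvdn_mulr // mulKn //.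
case: eqP => [_|/eqP pi0]; first by rewrite addr0.
case: ifP => [pd|]; last by rewrite addr0.
case: (p * i)%N pi0 pd (dvdn_mulr i (dvdnn p)) => //= n _ pn.
by rewrite -addn1 dvdn_addr // dvdn1 gtn_eqF.
Qed.

Lemma coef_emb1 a b i : (emb a b)`_(p * i).+1 = b`_i.
Proof.
rewrite coefD coefXM !coef_comp_poly_Xn // dvdn_p_succ /= dvdn_mulr // mulKn //.
by rewrite add0r.
Qed.

Lemma coef_emb_other a b i : (1 < i)%N ->
  ~~ ((p %| i) || (p %| i.-1))%N -> (emb a b)`_i = 0.
Proof.
case: i => // i _; rewrite negb_or => /andP [/negbTE ni /= /negbTE ni1].
by rewrite coefD coefXM !coef_comp_poly_Xn //= ni ni1 add0r.
Qed.

Lemma S_index i : ((p %| i) || (p %| i.-1))%N ->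
  exists j, i = (p * j)%N \/ i = (p * j).+1.
Proof.
case: i => [|i] /=; first by exists 0%N; left; rewrite muln0.
by case/orP => /dvdnP [j ->]; exists j; rewrite mulnC; [left|right].
Qed.

Lemma S_setP f : Nottingham f ->
  (forall n, exists a b, approx n f (emb a b)) -> S_set f.
Proof.
move=> Nf fn; split=> // i i1 ni; have [a [b ->]] := fn i.+1 => //.
exact: coef_emb_other.
Qed.

Lemma S_approx n f : S_set f -> exists a b, approx (p * n) f (emb a b).
Proof.
case=> -[f0 f1] fS.
exists (\poly_(i < n) f (p * i)%N), (\poly_(i < n) f (p * i).+1) => i lt_i.
have [|ni] := boolP ((p %| i) || (p %| i.-1))%N.
  case/S_index => j [] Ei; subst i.
    by rewrite coef_emb0 coef_poly -(ltn_pmul2l p_gt0) lt_i.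
  by rewrite coef_emb1 coef_poly -(ltn_pmul2l p_gt0) (ltn_trans _ lt_i).
(* Indices 0 and 1 pass the divisibility test, so an exceptional index is at least 2. *)
case: i ni lt_i => [|[|i]]; rewrite ?dvdn0 //= ?dvdn0 ?orbT // => ni lt_i.
by rewrite coef_emb_other //; apply: fS.
Qed.

Lemma scomp_approx_emb n f g A B a b : g 0%N = 0 ->
  approx n f (emb A B) -> approx n g (emb a b) ->
  approx n (scomp f g)
    (emb ((A \Po emb a b) + a * (B \Po emb a b)) (b * (B \Po emb a b))).
Proof. by move=> g0 fn gn; rewrite -emb_comp; apply: scomp_approx. Qed.

Lemma S_sid : S_set (sid p).
Proof.
by split=> // i i1 _; rewrite /sid gtn_eqF.
Qed.

Lemma S_scomp f g : S_set f -> S_set g -> S_set (scomp f g).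
Proof.
move=> Sf Sg; apply: S_setP => [|n].
  by apply: Nottingham_scomp; [case: Sf | case: Sg].
have [A [B fn]] := S_approx n Sf; have [a [b gn]] := S_approx n Sg.
have le_n : (n <= p * n)%N by rewrite leq_pmull.
by do 2!eexists; apply: approx_leq le_n (scomp_approx_emb _ fn gn); case: Sg => [[]].
Qed.

(* The first part of [f] is [c t^m + O(t^(m+1))]; for [lowB], the second part is
   [1 + c t^m + O(t^(m+1))]. *)
Definition lowA f m c := forall i, (i < m.+1)%N -> f (p * i)%N = (c%:P * 'X^m)`_i.
Definition lowB f m c := forall i, (i < m.+1)%N -> f (p * i).+1 = (1 + c%:P * 'X^m)`_i.

Lemma lowAP n f A B m c : approx (p * n) f (emb A B) -> (m < n)%N ->
  (lowA f m c <-> 'X^(m.+1) %| A - c%:P * 'X^m).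
Proof.
move=> fn lt_mn; have fE i : (i < m.+1)%N -> f (p * i)%N = A`_i.
  move=> le_im; rewrite fn ?coef_emb0 // ltn_pmul2l //; exact: leq_trans lt_mn.
split=> [lf|/dvdXnP lf i le_im].
  by apply/dvdXnP => i le_im; rewrite coefB -fE // lf // subrr.
by apply/eqP; rewrite fE // -subr_eq0 -coefB lf.
Qed.

Lemma lowBP n f A B m c : approx (p * n) f (emb A B) -> (m < n)%N ->
  (lowB f m c <-> 'X^(m.+1) %| B - (1 + c%:P * 'X^m)).
Proof.
move=> fn lt_mn; have fE i : (i < m.+1)%N -> f (p * i).+1 = B`_i.
  move=> le_im; rewrite fn ?coef_emb1 //; nia.
split=> [lf|/dvdXnP lf i le_im].
  by apply/dvdXnP => i le_im; rewrite coefB -fE // lf // subrr.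
by apply/eqP; rewrite fE // -subr_eq0 -coefB lf.
Qed.

Lemma lowA_coef f m c : lowA f m c -> f (p * m)%N = c.
Proof. by move=> /(_ m (ltnSn _)) ->; rewrite coefCM coefXn eqxx mulr1. Qed.

Lemma lowB_coef f m c : (0 < m)%N -> lowB f m c -> f (p * m).+1 = c.
Proof.
move=> m0 /(_ m (ltnSn _)) ->.
by rewrite coefD coef1 coefCM coefXn eqxx mulr1 gtn_eqF // add0r.
Qed.

Lemma lowA_leq m n f c : (m < n)%N -> lowA f n c -> lowA f m 0.
Proof.
move=> lt_mn lf i le_im; rewrite lf ?mul0r ?coef0.
  by rewrite coefCM coefXn ltn_eqF ?mulr0 //; apply: leq_trans lt_mn.
by apply: leq_trans (leqW lt_mn).
Qed.

Lemma lowB_leq m n f c : (m < n)%N -> lowB f n c -> lowB f m 0.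
Proof.
move=> lt_mn lf i le_im; rewrite lf ?mul0r ?addr0.
  by rewrite coefD coefCM coefXn ltn_eqF ?mulr0 ?addr0 //; apply: leq_trans lt_mn.
by apply: leq_trans (leqW lt_mn).
Qed.

Lemma lowA0 f : Nottingham f -> lowA f 0 0.
Proof. by case=> f0 _ [|//] _; rewrite muln0 f0 mul0r coef0. Qed.

Lemma lowB0 f : Nottingham f -> lowB f 0 0.
Proof. by case=> _ f1 [|//] _; rewrite muln0 f1 mul0r addr0 coef1. Qed.

Lemma lowA_next m f : lowA f m 0 -> lowA f m.+1 (f (p * m.+1)%N).
Proof.
move=> lf i; rewrite ltnS leq_eqVlt => /orP [/eqP ->|lt_im].
  by rewrite coefCM coefXn eqxx mulr1.
by rewrite lf // mul0r coef0 coefCM coefXn ltn_eqF ?mulr0.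
Qed.

Lemma lowB_next m f : lowB f m 0 -> lowB f m.+1 (f (p * m.+1).+1).
Proof.
move=> lf i; rewrite ltnS leq_eqVlt => /orP [/eqP ->|lt_im].
  by rewrite coefD coef1 coefCM coefXn eqxx mulr1 add0r.
by rewrite lf // mul0r addr0 coefD coefCM coefXn ltn_eqF ?mulr0 ?addr0.
Qed.

(** The lowest exponents left open are p(m+1) from the first part and p(n+1)+1 from the second. *)
Lemma low_agree f m n q : S_set f -> lowA f m 0 -> lowB f n 0 ->
  (q <= p * m.+1)%N -> (q <= (p * n.+1).+1)%N -> agree q f (sid p).
Proof.
move=> [[f0 f1] fS] lA lB qm qn i lt_iq; rewrite /sid.
case: eqP => [-> //|/eqP i1].
have [|ni] := boolP ((p %| i) || (p %| i.-1))%N.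
  case/S_index => j [] Ei; subst i.
    rewrite lA ?mul0r ?coef0 // -(ltn_pmul2l p_gt0).
    exact: leq_trans qm.
  rewrite lB ?mul0r ?addr0 ?coef1; last first.
    by rewrite -(ltn_pmul2l p_gt0) -ltnS; apply: leq_trans qn.
  by case: eqP => [j0|//]; rewrite j0 muln0 in i1.
case: i ni i1 {lt_iq} => [//|[//|i]] ni _.
exact: fS.
Qed.

End Decomposition.

(** Course-of-values recursion: [s n] lists the first n values, and by causality the list, padded
    with [x0], can stand for the whole function. *)
Lemma causal_fixpoint (T : Type) (x0 : T) (Phi : nat -> (nat -> T) -> T) :
  (forall n f g, (forall i, (i < n)%N -> f i = g i) -> Phi n f = Phi n g) ->
  exists f, forall n, f n = Phi n f.
Proof.
move=> causal.
pose s := fix s n := if n is m.+1 then rcons (s m) (Phi m (nth x0 (s m))) else [::].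
have size_s n : size (s n) = n by elim: n => //= n IH; rewrite size_rcons IH.
have nth_s n i : (i < n)%N -> nth x0 (s n) i = nth x0 (s i.+1) i.
  elim: n => // n IH; rewrite ltnS leq_eqVlt => /orP [/eqP -> //|lt_in].
  by rewrite -IH //= nth_rcons size_s lt_in.
exists (fun n => nth x0 (s n.+1) n) => n.
rewrite /= nth_rcons size_s ltnn eqxx; apply: causal => i /nth_s -> //.
Qed.

(** * Inverses in S and the commutator formula *)

Section Commutators.
Variable p : nat.
Hypothesis p_prime : prime p.
Implicit Types (f g h x : series p) (a b A B u v w : {poly 'F_p}).

Let p_gt1 : (1 < p)%N := prime_gt1 p_prime.
Let p_gt0 : (0 < p)%N := prime_gt0 p_prime.

Lemma S_inverse f : S_set f -> exists g, S_set g /\ scomp f g = sid p.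
Proof.
move=> Sf; have [Nf _] := Sf; have [f0 f1] := Nf.
(* Coefficient n of the inverse cancels coefficient n of [f] composed with the part already built;
   cutting makes this rule causal. The values 0 and 1 at n = 0, 1 start it. *)
pose cut n (g : series p) : series p := fun i => if (i < n)%N then g i else 0.
have [|g gE] := @causal_fixpoint _ (0 : 'F_p) (fun n g =>
  if (n <= 1)%N then n%:R else - scomp f (cut n g) n).
  move=> n g g' gg'; case: ifP => // _; congr (- scomp f _ n).
  by apply: functional_extensionality => i; rewrite /cut; case: ifP => // /gg'.
have g0 : g 0%N = 0 by rewrite gE.
have g1 : g 1%N = 1 by rewrite gE.
have cut0 n : cut n g 0%N = 0 by rewrite /cut g0 if_same.
have cut1 n : (1 < n)%N -> cut n g 1%N = 1 by rewrite /cut g1 => ->.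
(* By induction the part already built lies in S, so at an inadmissible exponent there is nothing to
   cancel. *)
have gS i : (1 < i)%N -> ~~ ((p %| i) || (p %| i.-1))%N -> g i = 0.
  elim/ltn_ind: i => i IH i1 ni; rewrite gE leqNgt i1 /=.
  suff Sc : S_set (cut i g) by rewrite (S_scomp p_prime Sf Sc).2 ?oppr0.
  split; first by split; rewrite ?cut0 ?cut1.
  by move=> j j1 nj; rewrite /cut; case: ifP => // lt_ji; apply: IH.
exists g; split; first by split.
apply: functional_extensionality => n.
have [n1|n1] := leqP n 1.
  by apply: (@agree_sid_scomp _ 2) => //; apply: Nottingham_agree2.
have cutn : cut n g n = 0 by rewrite /cut ltnn.
have /eqP : scomp f g n - scomp f (cut n g) n = g n - cut n g n.
  apply: scomp_next_coef => // [|i lt_in]; first exact: ltnW.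
  by rewrite /cut lt_in.
rewrite cutn subr0 subr_eq gE leqNgt n1 /= addNr => /eqP ->.
by rewrite /sid gtn_eqF.
Qed.

Definition poly_series u : series p := fun i => u`_i.

Lemma S_poly_series a b : a`_0 = 0 -> b`_0 = 1 -> S_set (poly_series (emb a b)).
Proof.
move=> a0 b0; apply: (S_setP p_prime) => [|n]; last by exists a, b.
by split; rewrite /poly_series -(muln0 p) ?(coef_emb0 p_prime) ?(coef_emb1 p_prime).
Qed.

Lemma approx_emb_low n f A B : (0 < n)%N -> Nottingham f ->
  approx (p * n) f (emb A B) ->
  [/\ 'X %| A, 'X %| B - 1, 'X %| emb A B & 'X^2 %| emb A B - 'X].
Proof.
move=> n0 Nf fn.
have := (lowAP p_prime 0 fn n0).1 (lowA0 Nf).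
have := (lowBP p_prime 0 fn n0).1 (lowB0 Nf).
rewrite !mul0r subr0 addr0 !expr1 => -> ->; split=> //.
  by case: Nf => f0 _; apply: approx_dvdX f0 fn; rewrite muln_gt0 p_gt0.
by apply: approx_Nottingham Nf fn; rewrite (leq_trans p_gt1) // leq_pmulr.
Qed.

Lemma approx_emb_dvd n f A B A' B' :
  approx (p * n) f (emb A B) -> approx (p * n) f (emb A' B') ->
  'X^n %| A - A' /\ 'X^n %| B - B'.
Proof.
move=> fn fn'; split; apply/dvdXnP => i lt_in; rewrite coefB.
  by rewrite -(coef_emb0 p_prime A B) -(coef_emb0 p_prime A' B') -fn ?fn' ?subrr
    ?ltn_pmul2l.
rewrite -(coef_emb1 p_prime A B) -(coef_emb1 p_prime A' B') -fn ?fn' ?subrr //; nia.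
Qed.

(** In the composition law, substituting g changes A and B only above their leading orders, and B o
    g is 1 plus higher terms. *)
Lemma scomp_low f g m e c c' d d' : (0 < m)%N -> (0 < e)%N ->
  S_set f -> S_set g -> lowA f m c -> lowB f e d -> lowA g m c' -> lowB g e d' ->
  lowA (scomp f g) m (c + c') /\ lowB (scomp f g) e (d + d').
Proof.
move=> m0 e0 Sf Sg; have [Nf _] := Sf; have [Ng _] := Sg; have [g0 _] := Ng.
pose n := (m + e).+1.
have [A [B fn]] := S_approx p_prime n Sf; have [a [b gn]] := S_approx p_prime n Sg.
have lt_m : (m < n)%N by rewrite /n; lia.
have lt_e : (e < n)%N by rewrite /n; lia.
have fgn := scomp_approx_emb p_prime g0 fn gn.
have [XA B1 XF F2] := approx_emb_low (ltn0Sn _) Nf fn.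
have [Xa b1 XG G2] := approx_emb_low (ltn0Sn _) Ng gn.
move=> /(lowAP p_prime _ fn lt_m) Am /(lowBP p_prime _ fn lt_e) Be.
move=> /(lowAP p_prime _ gn lt_m) am /(lowBP p_prime _ gn lt_e) be.
set G := emb a b in fgn XG G2.
have XA' : 'X^m %| A.
  have -> : A = (A - c%:P * 'X^m) + c%:P * 'X^m by ring.
  by apply: dvdp_add; [apply: dvdXn_leq Am | rewrite dvdp_mull].
have Xa' : 'X^m %| a.
  have -> : a = (a - c'%:P * 'X^m) + c'%:P * 'X^m by ring.
  by apply: dvdp_add; [apply: dvdXn_leq am | rewrite dvdp_mull].
have XB' : 'X^e %| B - 1.
  have -> : B - 1 = (B - (1 + d%:P * 'X^e)) + d%:P * 'X^e by ring.
  by apply: dvdp_add; [apply: dvdXn_leq Be | rewrite dvdp_mull].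
have BG1 : 'X %| (B \Po G) - 1.
  have -> : (B \Po G) - 1 = ((B - 1) \Po G) by rewrite comp_polyB comp_polyC.
  exact: dvdX_comp.
have AG : 'X^(m.+1) %| (A \Po G) - A.
  by rewrite -{2}[A]comp_polyXr -add1n dvdXn_sub_comp.
have BG : 'X^(e.+1) %| (B \Po G) - B.
  have -> : (B \Po G) - B = ((B - 1) \Po G) - ((B - 1) \Po 'X).
    by rewrite !comp_polyB !comp_polyC comp_polyXr; ring.
  by rewrite -add1n dvdXn_sub_comp.
split.
  apply/(lowAP p_prime _ fgn lt_m).
  have -> : (A \Po G) + a * (B \Po G) - (c + c')%:P * 'X^m =
    ((A \Po G) - A) + a * ((B \Po G) - 1) + (A - c%:P * 'X^m) + (a - c'%:P * 'X^m).
    by rewrite polyCD; ring.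
  do 3!apply: dvdp_add => //.
  by rewrite exprSr dvdp_mul.
apply/(lowBP p_prime _ fgn lt_e).
have -> : b * (B \Po G) - (1 + (d + d')%:P * 'X^e) =
  b * ((B \Po G) - B) + (b - (1 + d'%:P * 'X^e)) * B
    + d'%:P * ('X^e * (B - 1)) + (B - (1 + d%:P * 'X^e)).
  by rewrite polyCD; ring.
apply: dvdp_add => //; apply: dvdp_add; first apply: dvdp_add.
- by rewrite dvdp_mull.
- by rewrite dvdp_mulr.
- by rewrite dvdp_mull // exprSr dvdp_mul.
Qed.

(** The series t + c t^(pl+1). *)
Definition twist l c := poly_series (emb 0 (1 + c%:P * 'X^l)).

Lemma S_twist l c : (0 < l)%N -> S_set (twist l c).
Proof.
move=> l0; apply: S_poly_series; first by rewrite coef0.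
by rewrite coefD coef1 coefCM coefXn (ltn_eqF l0) mulr0 addr0.
Qed.

Lemma twist_agree l c n : (0 < l)%N -> (n <= l)%N -> agree n (twist l c) (sid p).
Proof.
case: l => // l _ le_nl.
have tn m : approx (p * m) (twist l.+1 c) (emb 0 (1 + c%:P * 'X^(l.+1))) by [].
apply: (@low_agree _ p_prime _ l l) => //; first exact: S_twist.
- by apply/(lowAP p_prime _ (tn l.+1)) => //; rewrite polyC0 mul0r subrr dvdp0.
- apply: (@lowB_leq _ _ l.+1 _ c) => //.
  by apply/(lowBP p_prime _ (tn l.+2)) => //; rewrite subrr dvdp0.
- by rewrite (leq_trans le_nl) // leq_pmull.
- by rewrite (leq_trans le_nl) // leqW // leq_pmull.
Qed.

(** With g the twist, [x] is the commutator (g o f)^-1 o f o g, given by an equation to avoid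
    inverses. The parts of f o g and g o f are compared, and their differences transferred to [x].
    The bound q + 2 <= l keeps the errors above the leading orders. *)
Lemma commutator_twist f x k l q al be c : (0 < k)%N -> (q.+2 <= l)%N ->
  S_set f -> S_set x -> lowA f k al -> agree q.+2 f (sid p) -> f q.+2 = be ->
  scomp (scomp (twist l c) f) x = scomp f (twist l c) ->
  lowA x (k + l) (- (c * al)) /\ lowB x (l + q).+1 (- (c * (l%:R * be))).
Proof.
move=> k0 le_ql.
set m := (k + l)%N; set e := (l + q).+1.
(* [n] is the working precision and [r] the depth to which [x] will be the identity. *)
pose n := (m + e).+1; pose r := minn (p * m) (p * e).+1.
have l0 : (0 < l)%N by apply: leq_trans le_ql.
have lt_m : (m < n)%N by rewrite /n; lia.
have lt_e : (e < n)%N by rewrite /n; lia.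
have lt_k : (k < n)%N by rewrite /n /m; lia.
have lt_qn : (q.+3 <= n)%N by rewrite /n /m /e; lia.
have le_mpl : (m.+1 <= p * l + k)%N by rewrite /m; nia.
have le_epl : (e.+1 <= (p * l).+1)%N by rewrite /e; nia.
have le_rn : (r <= p * n)%N by rewrite /r /n; nia.
have r_gt0 : (0 < r)%N by rewrite /r /m; nia.
have p2m : (2 * m <= p * m)%N by rewrite leq_mul2r p_gt1 orbT.
have p2e : (2 * e <= p * e)%N by rewrite leq_mul2r p_gt1 orbT.
have le_mr : (m.+1 <= r.-1 + k)%N.
  by rewrite /r; move: (p * m)%N (p * e)%N p2m p2e => ? ?; lia.
have le_er : (e.+1 <= r)%N.
  by rewrite /r; move: (p * m)%N (p * e)%N p2m p2e => ? ?; lia.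
have le_l1 : (l.+1 <= (l + q).+1)%N by lia.
have le_rm : (r <= p * m)%N by rewrite geq_minl.
have le_re : (r <= (p * e).+1)%N by rewrite geq_minr.
clearbody r.
move=> Sf Sx + fq fqb fx; have [Nf _] := Sf; have [Nx _] := Sx.
have [f0 _] := Nf; have [x0 _] := Nx.
have [A [B fn]] := S_approx p_prime n Sf; have [ax [bx xn]] := S_approx p_prime n Sx.
move=> /(lowAP p_prime _ fn) Ak; have {}Ak := Ak lt_k.
have Sg := S_twist c l0; have [[g0 _] _] := Sg.
pose bg : {poly 'F_p} := 1 + c%:P * 'X^l.
have gn : approx (p * n) (twist l c) (emb 0 bg) by [].
set g := twist l c in fx Sg gn g0.
have gfn := scomp_approx_emb p_prime f0 gn fn.
have fgn := scomp_approx_emb p_prime g0 fn gn.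
have gfxn := scomp_approx_emb p_prime x0 gfn xn.
have [XA B1 XF F2] := approx_emb_low (ltn0Sn _) Nf fn.
have [_ _ XG G2] := approx_emb_low (ltn0Sn _) Sg.1 gn.
have [Xax bx1 XX X2] := approx_emb_low (ltn0Sn _) Nx xn.
rewrite fx in gfxn; rewrite comp_poly0 add0r in gfn gfxn; rewrite mul0r addr0 in fgn.
set F := emb A B in gfn gfxn XF F2; set G := emb 0 bg in fgn XG G2.
set X := emb ax bx in gfxn XX X2.
set AX := A * (bg \Po F) in gfn gfxn; set BX := B * (bg \Po F) in gfn gfxn.
have FX : 'X^(q.+3) %| F - 'X - be%:P * 'X^(q.+2).
  have lt_q i : (i < q.+3)%N -> (i < p * n)%N.
    move=> lt_iq; apply: (@leq_trans n); last by rewrite leq_pmull.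
    exact: leq_trans lt_qn.
  apply/dvdXnP => i lt_iq; rewrite !coefB coefX coefCM coefXn -fn ?lt_q //.
  move: lt_iq; rewrite ltnS leq_eqVlt => /orP [/eqP ->|lt_iq].
    by rewrite fqb eqxx mulr1 subr0 subrr.
  rewrite fq // /sid (ltn_eqF lt_iq) mulr0 subr0.
  by case: eqP => _; rewrite subrr.
have Fl := dvdXn_exp_lead l FX.
have Fl1 : 'X^(l.+1) %| F ^+ l - 'X^l.
  have -> : F ^+ l - 'X^l = (F ^+ l - 'X^l - (l%:R * be)%:P * 'X^((l + q).+1))
     + (l%:R * be)%:P * 'X^((l + q).+1) by ring.
  apply: dvdp_add; first exact: dvdXn_leq (leqW le_l1) Fl.
  by rewrite dvdp_mull // dvdp_exp2l.
(* [G] is so close to X that substituting it into [A] and [B] does not affect the orders [m] and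
   [e]. *)
have GX : 'X^((p * l).+1) %| G - 'X.
  have -> : G - 'X = c%:P * 'X^((p * l).+1).
    rewrite /G /emb /bg comp_poly0 add0r comp_polyD comp_polyM !comp_polyC.
    by rewrite comp_Xn_poly -exprM exprS; ring.
  by rewrite dvdp_mull.
have bgF : (bg \Po F) = 1 + c%:P * F ^+ l.
  by rewrite /bg comp_polyD comp_polyM !comp_polyC comp_Xn_poly.
have XA' : 'X^k %| A.
  have -> : A = (A - al%:P * 'X^k) + al%:P * 'X^k by ring.
  by apply: dvdp_add; [apply: dvdXn_leq Ak | rewrite dvdp_mull].
have bgF1 : 'X %| (bg \Po F) - 1.
  have -> : (bg \Po F) - 1 = c%:P * F ^+ l by rewrite bgF; ring.
  by rewrite dvdp_mull // -(prednK l0) exprS dvdp_mulr.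
have BX1 : 'X %| BX - 1.
  have -> : BX - 1 = B * ((bg \Po F) - 1) + 1 * (B - 1) by rewrite /BX; ring.
  exact: dvdp_comb.
(* The first part of g o f is A (1 + c F^l), exceeding A by c al t^(k+l) to leading order. *)
have dA : 'X^(m.+1) %| (A \Po G) - AX - (- (c * al))%:P * 'X^m.
  have -> : (A \Po G) - AX - (- (c * al))%:P * 'X^m =
    ((A \Po G) - A) - c%:P * (F ^+ l * (A - al%:P * 'X^k)
      + al%:P * ('X^k * (F ^+ l - 'X^l))).
    by rewrite /AX bgF polyCN polyCM exprD; ring.
  apply: dvdp_sub.
    rewrite -{2}[A]comp_polyXr.
    apply: dvdXn_leq (dvdXn_sub_comp XA' XG (dvdpp _) GX).
    exact: le_mpl.
  apply: dvdp_mull; apply: dvdp_add.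
    apply: dvdXn_leq (dvdXn_mul (dvdXn_exp l XF) Ak).
    by rewrite addnS addnC.
  apply: dvdp_mull.
  apply: dvdXn_leq (dvdXn_mul (dvdpp _) Fl1).
  by rewrite addnS.
(* The products bg B cancel and leave - c B (F^l - X^l), whose leading term comes from
   [dvdXn_exp_lead]. *)
have dB : 'X^(e.+1) %| bg * (B \Po G) - BX - (- (c * (l%:R * be)))%:P * 'X^e.
  have -> : bg * (B \Po G) - BX - (- (c * (l%:R * be)))%:P * 'X^e =
    bg * ((B \Po G) - B) - (B * c%:P * (F ^+ l - 'X^l - (l%:R * be)%:P * 'X^e)
      + (c * (l%:R * be))%:P * ('X^e * (B - 1))).
    by rewrite /BX bgF /bg polyCN !polyCM; ring.
  apply: dvdp_sub; last first.
    by apply: dvdp_add; apply: dvdp_mull => //; rewrite exprSr dvdp_mul.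
  apply: dvdp_mull; rewrite -{2}[B]comp_polyXr.
  apply: dvdp_trans (dvdp_sub_comp B G 'X).
  exact: dvdXn_leq GX.
(* f o g and g o f agree below [r]; left cancellation passes this on to [x]. *)
have xr : agree r x (sid p).
  apply: (agree_scomp_cancel (Nottingham_scomp Sg.1 Nf)) => //.
  rewrite scomp_idr fx.
  apply/(approx_agreeP (approx_leq le_rn fgn) (approx_leq le_rn gfn)).
  have -> : emb (A \Po G) (bg * (B \Po G)) - emb AX BX =
    (((A \Po G) - AX) \Po 'X^p) + 'X * ((bg * (B \Po G) - BX) \Po 'X^p).
    by rewrite /emb !comp_polyB; ring.
  apply: dvdp_add.
    have: 'X^m %| (A \Po G) - AX.
      have -> : (A \Po G) - AX = ((A \Po G) - AX - (- (c * al))%:P * 'X^m)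
        + (- (c * al))%:P * 'X^m by ring.
      by apply: dvdp_add; [apply: dvdXn_leq dA | rewrite dvdp_mull].
    case/dvdpP=> w ->; rewrite comp_polyM comp_Xn_poly -exprM dvdp_mull //.
    by rewrite dvdp_exp2l.
  have: 'X^e %| bg * (B \Po G) - BX.
    have -> : bg * (B \Po G) - BX =
      (bg * (B \Po G) - BX - (- (c * (l%:R * be)))%:P * 'X^e)
      + (- (c * (l%:R * be)))%:P * 'X^e by ring.
    by apply: dvdp_add; [apply: dvdXn_leq dB | rewrite dvdp_mull].
  case/dvdpP=> w ->; rewrite comp_polyM comp_Xn_poly -exprM mulrCA -exprS.
  by rewrite dvdp_mull // dvdp_exp2l.
have Xr : 'X^r %| X - 'X.
  by apply/(approx_agreeP (approx_leq le_rn xn) (@approx_sid _ r)).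
have BXX1 : 'X %| (BX \Po X) - 1.
  have -> : (BX \Po X) - 1 = ((BX - 1) \Po X) by rewrite comp_polyB comp_polyC.
  exact: dvdX_comp.
(* The parts of (g o f) o x and f o g are equated. Substituting [x] costs only higher terms, and a
   factor with constant term 1 is then divided out. *)
have [eqA eqB] := approx_emb_dvd gfxn fgn.
split.
  apply/(lowAP p_prime _ xn lt_m); apply: (dvdXn_lead_quot BXX1).
  have -> : ax * (BX \Po X) - (- (c * al))%:P * 'X^m =
    ((AX \Po X) + ax * (BX \Po X) - (A \Po G)) - ((AX \Po X) - AX)
    + ((A \Po G) - AX - (- (c * al))%:P * 'X^m) by ring.
  apply: dvdp_add => //; apply: dvdp_sub; first exact: dvdXn_leq eqA.
  rewrite -{2}[AX]comp_polyXr -(prednK r_gt0) in Xr *.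
  have XAX : 'X^k %| AX by rewrite dvdp_mulr.
  apply: dvdXn_leq (dvdXn_sub_comp XAX XX (dvdpp _) Xr).
  exact: le_mr.
apply/(lowBP p_prime _ xn lt_e).
have -> : bx - (1 + (- (c * (l%:R * be)))%:P * 'X^e) =
  (bx - 1) - (- (c * (l%:R * be)))%:P * 'X^e by ring.
apply: (dvdXn_lead_quot BX1).
have -> : (bx - 1) * BX - (- (c * (l%:R * be)))%:P * 'X^e =
  (bx * (BX \Po X) - bg * (B \Po G)) - bx * ((BX \Po X) - BX)
  + (bg * (B \Po G) - BX - (- (c * (l%:R * be)))%:P * 'X^e) by ring.
apply: dvdp_add => //; apply: dvdp_sub; first exact: dvdXn_leq eqB.
apply: dvdp_mull; rewrite -{2}[BX]comp_polyXr.
apply: dvdp_trans (dvdp_sub_comp BX X 'X).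
exact: dvdXn_leq Xr.
Qed.

Lemma S_approx_lin n f : S_set f -> (forall i, f (p * i)%N = 0) ->
  exists B, approx (p * n) f (emb 0 B).
Proof.
move=> Sf fA; have [A [B fn]] := S_approx p_prime n Sf; exists B => i lt_i.
rewrite fn //; apply/eqP; rewrite -subr_eq0 -coefB; apply/eqP.
apply: (dvdXnP (p * n) _ _) => //.
have -> : emb A B - emb 0 B = (A \Po 'X^p) by rewrite /emb comp_poly0; ring.
have /dvdpP [w ->] : 'X^n %| A.
  apply/dvdXnP => j lt_j; rewrite -(coef_emb0 p_prime A B) -fn ?fA //.
  by rewrite ltn_pmul2l.
by rewrite comp_polyM comp_Xn_poly -exprM dvdp_mull.
Qed.

(* If [x = t b(t^p)], comparing the two parts of [f o u = u o x] for
   [u = t + t^(p l)] gives [b(t) = b(t^p)^l], which forces [b = 1]. *)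
Lemma conjugate_shift f x l : (0 < l)%N -> S_set f -> S_set x ->
  (forall i, f (p * i)%N = 0) -> (forall i, x (p * i)%N = 0) ->
  scomp f (poly_series (emb 'X^l 1)) = scomp (poly_series (emb 'X^l 1)) x ->
  f = sid p.
Proof.
move=> l0 Sf Sx fA xA fx; have [Nf _] := Sf; have [Nx _] := Sx.
have [f0 _] := Nf; have [x0 _] := Nx.
have lA m : lowA f m 0 by move=> i _; rewrite fA mul0r coef0.
suff lB m : lowB f m 0.
  apply: series_eq => n; apply: (@low_agree _ p_prime _ n n) => //; nia.
elim: m => [|m /lowB_next]; first exact: lowB0.
set be := f _; set e := m.+1 => lf; suff be0 : be = 0 by rewrite -be0.
(* The l extra orders pay for cancelling X^l from the first parts. *)
pose n := (l + e).+1; have lt_e : (e < n)%N by rewrite /n; lia.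
have [B fn] := S_approx_lin n Sf fA; have [b xn] := S_approx_lin n Sx xA.
set u := poly_series _ in fx.
have Su : S_set u.
  by apply: S_poly_series; rewrite ?coef1 // coefXn (ltn_eqF l0).
have [Nu _] := Su; have [u0 _] := Nu.
have un : approx (p * n) u (emb 'X^l 1) by [].
have fun_ := scomp_approx_emb p_prime u0 fn un.
have uxn := scomp_approx_emb p_prime x0 un xn.
have [_ B1 _ _] := approx_emb_low (ltn0Sn _) Nf fn.
have [_ b1 _ _] := approx_emb_low (ltn0Sn _) Nx xn.
have [_ _ XU U2] := approx_emb_low (ltn0Sn _) Nu un.
rewrite fx in fun_; have [] := approx_emb_dvd fun_ uxn.
set U := emb 'X^l 1 in U2 XU *; rewrite comp_Xn_poly comp_poly0 !comp_polyC.
rewrite mul1r !mul0r mulr1 addr0 add0r => eqA eqB.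
move/(lowBP p_prime _ fn lt_e): lf => Be.
have XB : 'X^e %| B - 1.
  have -> : B - 1 = (B - (1 + be%:P * 'X^e)) + be%:P * 'X^e by ring.
  by apply: dvdp_add; [apply: dvdXn_leq Be | rewrite dvdp_mull].
have BU : 'X^(e.+1) %| (B \Po U) - (1 + be%:P * 'X^e).
  have -> : (B \Po U) - (1 + be%:P * 'X^e) =
    (((B - 1) \Po U) - ((B - 1) \Po 'X)) + (B - (1 + be%:P * 'X^e)).
    by rewrite !comp_polyB !comp_polyC comp_polyXr; ring.
  by rewrite dvdp_add // -add1n dvdXn_sub_comp.
have {}eqA : 'X^(e.+1) %| (B \Po U) - (b \Po 'X^p) ^+ l.
  move: eqA; rewrite /emb comp_poly0 add0r exprMn -mulrBr /n -addnS exprD.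
  by rewrite dvdp_mul2l // expf_neq0 // polyX_eq0.
have Xb : 'X^e %| b - 1.
  have -> : b - 1 = ((B \Po U) - (1 + be%:P * 'X^e)) + be%:P * 'X^e - ((B \Po U) - b).
    by ring.
  apply: dvdp_sub; last by apply: dvdXn_leq eqB; lia.
  by apply: dvdp_add; [apply: dvdXn_leq BU | rewrite dvdp_mull].
(* b(t^p) - 1 has order at least pe > e, so the term [be] of order e must vanish. *)
have Xbp : 'X^(e.+1) %| (b \Po 'X^p) ^+ l - 1.
  rewrite -[X in _ - X](expr1n _ l) subrXX; apply: dvdp_mulr.
  have -> : (b \Po 'X^p) - 1 = ((b - 1) \Po 'X^p) by rewrite comp_polyB comp_polyC.
  case/dvdpP: Xb => w ->; rewrite comp_polyM comp_Xn_poly -exprM dvdp_mull //.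
  by rewrite dvdp_exp2l // /e; nia.
have : 'X^(e.+1) %| be%:P * 'X^e.
  have -> : be%:P * 'X^e = ((B \Po U) - (b \Po 'X^p) ^+ l) + ((b \Po 'X^p) ^+ l - 1)
    - ((B \Po U) - (1 + be%:P * 'X^e)) by ring.
  by apply: dvdp_sub => //; apply: dvdp_add.
by move/dvdXnP/(_ e (ltnSn _)); rewrite coefCM coefXn eqxx mulr1.
Qed.

End Commutators.

(** * Division and commutators in subgroups *)

Section Subgroups.
Variable p : nat.
Implicit Types (f g h x y : series p) (G A H N : series p -> Prop).

(** [subgroup] supplies a right inverse; left cancellation of [f] makes it two-sided. *)
Lemma subgroup_inv G A f : subset_of G (@Nottingham p) -> subgroup G A -> A f ->
  exists g, [/\ A g, scomp f g = sid p & scomp g f = sid p].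
Proof.
move=> GJ [AG [_ [_ Ai]]] Af; have [g [Ag fg]] := Ai f Af.
have Nf := GJ _ (AG _ Af); have [f0 _] := Nf; have [g0 _] := GJ _ (AG _ Ag).
exists g; split=> //; apply: (scomp_cancel Nf); rewrite ?scomp0 //.
by rewrite -scompA // fg scomp_idl // scomp_idr.
Qed.

Lemma subgroup_ldiv G A x y : subset_of G (@Nottingham p) -> subgroup G A ->
  A x -> A y -> exists z, A z /\ scomp x z = y.
Proof.
move=> GJ sA Ax Ay; have [x' [Ax' xx' _]] := subgroup_inv GJ sA Ax.
have [AG [_ [Am _]]] := sA; exists (scomp x' y); split; first exact: Am.
have [x0 _] := GJ _ (AG _ Ax'); have [y0 _] := GJ _ (AG _ Ay).
by rewrite -scompA // xx' scomp_idl.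
Qed.

Lemma subgroup_rdiv G A x y : subset_of G (@Nottingham p) -> subgroup G A ->
  A x -> A y -> exists z, A z /\ scomp z x = y.
Proof.
move=> GJ sA Ax Ay; have [x' [Ax' _ x'x]] := subgroup_inv GJ sA Ax.
have [AG [_ [Am _]]] := sA; exists (scomp y x'); split; first exact: Am.
have [x'0 _] := GJ _ (AG _ Ax'); have [x0 _] := GJ _ (AG _ Ax).
by rewrite scompA // x'x scomp_idr.
Qed.

(** Normality gives f o h = h o n' with n' in N, and x is the quotient of n' by f. *)
Lemma normal_commutator H N f h : subset_of H (@Nottingham p) ->
  normal_subgroup H N -> N f -> H h ->
  exists x, N x /\ scomp (scomp h f) x = scomp f h.
Proof.
move=> HJ [sN Nn] Nf Hh; have [n' [Nn' ->]] := Nn _ _ Hh Nf.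
have [x [Nx <-]] := subgroup_ldiv HJ sN Nf Nn'; exists x; split=> //.
have [NH _] := sN; have [f0 _] := HJ _ (NH _ Nf); have [x0 _] := HJ _ (NH _ Nx).
by rewrite scompA.
Qed.

End Subgroups.

(** * Non-trivial closed normal subgroups of open subgroups are open *)

Section JustInfinite.
Variable p : nat.
Hypothesis p_prime : prime p.
Implicit Types (f g h x y : series p).

Let p_gt1 : (1 < p)%N := prime_gt1 p_prime.
Let p_gt0 : (0 < p)%N := prime_gt0 p_prime.

Lemma S_subgroup : subgroup (@Nottingham p) (@S_set p).
Proof.
split; first by move=> f [].
split; first exact: S_sid.
by split; [apply: S_scomp | apply: S_inverse].
Qed.

Lemma lowB_leq0 m n f : (m <= n)%N -> lowB f n 0 -> lowB f m 0.
Proof.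
by rewrite leq_eqVlt => /orP [/eqP -> //|lt_mn]; apply: lowB_leq.
Qed.

Lemma lowA_leq0 m n f : (m <= n)%N -> lowA f n 0 -> lowA f m 0.
Proof.
by rewrite leq_eqVlt => /orP [/eqP -> //|lt_mn]; apply: lowA_leq.
Qed.

Lemma shift_agree n l : (0 < l)%N -> (n <= l)%N ->
  agree n (poly_series (emb 'X^l 1)) (sid p).
Proof.
case: l => // l _ le_nl; set u := poly_series _.
have un m : approx (p * m) u (emb 'X^(l.+1) 1) by [].
have lA : lowA u l.+1 1.
  by apply/(lowAP p_prime _ (un l.+2)) => //; rewrite polyC1 mul1r subrr dvdp0.
have lB : lowB u l 0.
  by apply/(lowBP p_prime _ (un l.+1)) => //; rewrite mul0r addr0 subrr dvdp0.
apply: (@low_agree _ p_prime _ l l) => //; [|exact: lowA_leq lA|nia|nia].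
by apply: S_poly_series; rewrite ?coefXn ?coef1.
Qed.

Variables H N : series p -> Prop.
Hypothesis sub_H : subgroup (@S_set p) H.
Hypothesis open_H : open_in (@S_set p) H.
Hypothesis normal_N : normal_subgroup H N.
Hypothesis closed_N : closed_in H N.
Hypothesis nontriv_N : exists f, N f /\ f <> sid p.

Let sub_N : subgroup H N := normal_N.1.

Let HS f : H f -> S_set f. Proof. exact: sub_H.1. Qed.
Let NH f : N f -> H f. Proof. exact: sub_N.1. Qed.
Let NS f : N f -> S_set f. Proof. by move/NH/HS. Qed.
Let HJ : subset_of H (@Nottingham p). Proof. by move=> f /HS []. Qed.

Lemma open_contains : exists n0, forall f, S_set f -> agree n0 f (sid p) -> H f.
Proof.
have [_ oH] := open_H; have [n0 Hn0] := oH _ sub_H.2.1.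
by exists n0 => f Sf fn; apply: Hn0 => //; apply: agree_sym.
Qed.

(** If all first parts in [N] vanished, conjugating by a deep shift t + t^(pl) in [H] would stay
    among such elements, and [conjugate_shift] would make [N] trivial. *)
Lemma lowA_nonzero : exists f k c, [/\ N f, (0 < k)%N, lowA f k c & c != 0].
Proof.
have [n0 Hn0] := open_contains; have [f [Nf f_id]] := nontriv_N.
suff [x [Nx [i xi]]] : exists x, N x /\ exists i, x (p * i)%N != 0.
  have exi : exists i, x (p * i)%N != 0 by exists i.
  case: (ex_minnP exi) => k xk k_min; have [[x0 _] _] := NS Nx.
  exists x, k, (x (p * k)%N); split=> //.
    by case: k xk {k_min} => //; rewrite muln0 x0 eqxx.
  move=> j; rewrite ltnS leq_eqVlt => /orP [/eqP ->|lt_jk].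
    by rewrite coefCM coefXn eqxx mulr1.
  rewrite coefCM coefXn (ltn_eqF lt_jk) mulr0; apply/eqP/negP => /negP xj.
  by have := k_min _ xj; rewrite leqNgt lt_jk.
apply: NNPP => noA.
have zA x : N x -> forall i, x (p * i)%N = 0.
  move=> Nx i; apply/eqP; apply/negPn/negP => xi.
  by apply: noA; exists x; split=> //; exists i.
set u : series p := poly_series (emb 'X^(n0.+1) 1).
have Hu : H u.
  apply: Hn0; last exact: shift_agree.
  by apply: S_poly_series => //; rewrite ?coefXn ?coef1.
have [x [Nx fx]] := normal_N.2 _ _ Hu Nf.
apply: f_id; apply: (@conjugate_shift _ p_prime _ x n0.+1) => //.
- exact: NS.
- exact: NS.
- exact: zA.
- exact: zA.
Qed.

Lemma twist_step : exists L, forall f k q (al : 'F_p) l (c : 'F_p), N f -> (0 < k)%N ->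
  lowA f k al -> agree q.+2 f (sid p) -> (q.+2 <= l)%N -> (L <= l)%N ->
  exists x, [/\ N x, lowA x (k + l) (- (c * al)) &
    lowB x (l + q).+1 (- (c * (l%:R * f q.+2)))].
Proof.
have [n0 Hn0] := open_contains; exists n0 => f k q al l c Nf k0 fA fq le_ql le_nl.
have l0 : (0 < l)%N by apply: leq_trans le_ql.
have Ht : H (twist l c).
  by apply: Hn0; [apply: S_twist | apply: twist_agree].
have [x [Nx fx]] := normal_commutator HJ normal_N Nf Ht.
have [xA xB] := commutator_twist p_prime k0 le_ql (NS Nf) (NS Nx) fA fq erefl fx.
by exists x.
Qed.

(** The first commutator [x1] has a first part starting at k + l1 but depth at least p(l1+1) in t.
    This factor p pushes the second part of the next commutator far beyond its first part. *)
Lemma lowA_all D : exists M, forall m c, (M <= m)%N ->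
  exists x, [/\ N x, lowA x m c & lowB x (m + D) 0].
Proof.
have [L step] := twist_step; have [f [k [al [Nf k0 fA al0]]]] := lowA_nonzero.
(* Large enough that p(l1+1) - 1 > k + l1 + D for every p. *)
pose l1 := (L + D + k + 2)%N.
have [x1 [Nx1 x1A x1B]] : exists x, [/\ N x, lowA x (k + l1) 1 & lowB x l1 0].
  have f2 : agree 2 f (sid p) by apply: Nottingham_agree2; case: (NS Nf).
  (* Only depth 2 is known of [f], hence q = 0; the twist parameter normalises the leading
     coefficient to 1. *)
  have [||x [Nx xA xB]] := step f k 0%N al l1 (- al^-1) Nf k0 fA f2; try lia.
  exists x; split=> //; first by move: xA; rewrite mulNr mulVf // opprK.
  by apply: lowB_leq xB; lia.
pose q := (p * l1.+1 - 2)%N; have qE : (q.+2 = p * l1.+1)%N by rewrite /q; nia.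
have x1q : agree q.+2 x1 (sid p).
  apply: (@low_agree _ p_prime _ l1 l1); rewrite ?qE //; first exact: NS.
  by apply: lowA_leq x1A; lia.
exists (k + l1 + q.+2 + L)%N => m c le_m.
pose l := (m - (k + l1))%N; have -> : m = ((k + l1) + l)%N by rewrite /l; lia.
have k1 : (0 < k + l1)%N by lia.
have [||x [Nx xA xB]] := step x1 (k + l1)%N q 1 l (- c) Nx1 k1 x1A x1q;
  try (rewrite /l; lia).
exists x; split=> //; first by move: xA; rewrite mulr1 opprK.
apply: lowB_leq xB; nia.
Qed.

(** First-part coefficients are removed one by one. The corrections start at order m + 1 or later,
    so their second parts are 1 through order m + 1 + D >= e and the term [c] survives. *)
Lemma clear_A M D : (forall m c, (M <= m)%N ->
    exists x, [/\ N x, lowA x m c & lowB x (m + D) 0]) ->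
  forall x m e c K, N x -> (0 < e)%N -> (M <= m.+1)%N -> (e <= m.+1 + D)%N ->
    lowA x m 0 -> lowB x e c ->
  exists y, [/\ N y, lowA y K 0 & lowB y e c].
Proof.
move=> hasA x m e c K Nx e0 le_Mm le_em xA xB.
suff [y [Ny yA yB]] : exists y, [/\ N y, lowA y (m + K) 0 & lowB y e c].
  by exists y; split=> //; apply: lowA_leq0 yA; lia.
elim: K => [|K [y [Ny yA yB]]]; first by rewrite addn0; exists x.
have {}yA := lowA_next yA; rewrite addnS.
have [|z [Nz zA zB]] := hasA (m + K).+1 (- y (p * (m + K).+1)%N); first by lia.
have {}zB : lowB z e 0 by apply: lowB_leq0 zB; lia.
have [yzA yzB] := scomp_low p_prime (ltn0Sn _) e0 (NS Ny) (NS Nz) yA yB zA zB.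
exists (scomp y z); split; first exact: sub_N.2.2.1.
  by move: yzA; rewrite subrr.
by move: yzB; rewrite addr0.
Qed.

Let natr_neq0 l : ~~ (p %| l)%N -> l%:R != 0 :> 'F_p.
Proof. by rewrite (dvdn_pcharf (pchar_Fp p_prime)). Qed.

(** For f = t + t^(pk) + ... the second part of the commutator has order e = l + pk - 1 and a
    coefficient proportional to l, that is, to e + 1 modulo p. *)
Lemma lowB_all_succ : exists L, forall e c K, (L <= e)%N -> ~~ (p %| e.+1)%N ->
  exists y, [/\ N y, lowA y K 0 & lowB y e c].
Proof.
have [L step] := twist_step; have [M0 hasA0] := lowA_all 0.
pose k := M0.+1; have [|f [Nf fA fB]] := hasA0 k 1; first exact: leqnSn.
(* The first part of the commutator starts at k + l, before e; a margin of pk lets it be cleared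
   safely. *)
have [M1 hasA1] := lowA_all (p * k).
pose q := (p * k - 2)%N; have qE : (q.+2 = p * k)%N by rewrite /q; nia.
have fq : agree q.+2 f (sid p).
  apply: (@low_agree _ p_prime _ M0 k); rewrite ?qE //.
  - exact: NS.
  - exact: lowA_leq fA.
  - by rewrite addn0 in fB.
  - by rewrite leqW // leq_pmul2l.
exists (2 * (p * k) + L + M1)%N => e c K le_e npe.
pose l := (e.+1 - p * k)%N; have el : (e.+1 = l + p * k)%N by rewrite /l; lia.
have l_neq0 : l%:R != 0 :> 'F_p.
  by apply: natr_neq0; move: npe; rewrite el dvdn_addl // dvdn_mulr.
have [||x [Nx xA xB]] := step f k q 1 l (- (c / l%:R)) Nf (ltn0Sn _) fA fq;
  try lia.
have eE : ((l + q).+1 = e)%N by lia.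
rewrite eE qE (lowA_coef fA) mulr1 mulNr opprK mulfVK // in xB.
apply: (clear_A hasA1 (m := (M0 + l)%N) _ Nx) => //; try lia.
by apply: lowA_leq xA; rewrite /k; lia.
Qed.

(** For f = t + t^(pj+1) + ... the order is e = l + pj, and the factor l is e modulo p. *)
Lemma lowB_all_pos : exists L, forall e c K, (L <= e)%N -> ~~ (p %| e)%N ->
  exists y, [/\ N y, lowA y K 0 & lowB y e c].
Proof.
have [L step] := twist_step; have [M0 hasA0] := lowA_all 0.
have [L1 hasB] := lowB_all_succ.
(* Taking j divisible by p makes [lowB_all_succ] applicable. Clearing through [K0] = pj puts the
   first part of the commutator beyond e. *)
pose j := (p * L1.+1)%N; pose K0 := (p * j)%N.
have [||f [Nf fA fB]] := hasB j 1 K0; first by rewrite /j; nia.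
  by rewrite dvdn_p_succ.
have j0 : (0 < j)%N by rewrite /j; nia.
pose q := (p * j - 1)%N; have qE : (q.+2 = (p * j).+1)%N by rewrite /q; nia.
have fq : agree q.+2 f (sid p).
  apply: (@low_agree _ p_prime _ K0 j.-1); rewrite ?qE //.
  - exact: NS.
  - by apply: lowB_leq fB; lia.
  - by rewrite /K0; nia.
  - by rewrite prednK.
have {}fA := lowA_next fA.
exists (2 * (p * j).+1 + L + M0)%N => e c K le_e npe.
pose l := (e - p * j)%N; have el : (e = l + p * j)%N by rewrite /l; lia.
have l_neq0 : l%:R != 0 :> 'F_p.
  by apply: natr_neq0; move: npe; rewrite el dvdn_addl // dvdn_mulr.
have [||x [Nx xA xB]] := step f K0.+1 q _ l (- (c / l%:R)) Nf (ltn0Sn _) fA fq;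
  try lia.
have eE : ((l + q).+1 = e)%N by lia.
rewrite eE qE (lowB_coef j0 fB) mulr1 mulNr opprK mulfVK // in xB.
apply: (clear_A hasA0 (m := (K0 + l)%N) _ Nx) => //; try (rewrite /K0; lia).
by apply: lowA_leq xA; lia.
Qed.

Lemma lowB_all : exists L, forall e c K, (L <= e)%N ->
  exists y, [/\ N y, lowA y K 0 & lowB y e c].
Proof.
have [L1 h1] := lowB_all_succ; have [L2 h2] := lowB_all_pos.
exists (L1 + L2)%N => e c K le_e.
have [pe|npe] := boolP (p %| e)%N; last by apply: h2 => //; lia.
apply: h1; first by lia.
by rewrite -addn1 dvdn_addr // dvdn1 gtn_eqF.
Qed.

Lemma leading_terms : exists n1, forall n c, (n1 <= n)%N ->
  ((p %| n) || (p %| n.-1))%N ->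
  exists d, [/\ N d, agree n d (sid p) & d n = c].
Proof.
have [M hasA] := lowA_all 0; have [L hasB] := lowB_all.
exists (p * (M + L).+1).+2 => n c le_n /S_index [] m [] En; subst n.
  have [|x [Nx xA xB]] := hasA m c; first by nia.
  exists x; split; [by []| |exact: lowA_coef xA].
  have m0 : (0 < m)%N by nia.
  apply: (@low_agree _ p_prime _ m.-1 m); rewrite ?prednK //.
  - exact: NS.
  - by apply: lowA_leq xA; lia.
  - by rewrite addn0 in xB.
  - by nia.
have [|x [Nx xA xB]] := hasB m c m; first by nia.
have m0 : (0 < m)%N by nia.
exists x; split; [by []| |exact: lowB_coef xB].
apply: (@low_agree _ p_prime _ m m.-1); rewrite ?prednK //.
- exact: NS.
- by apply: lowB_leq xB; lia.
- by nia.
Qed.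

Lemma closed_normal_open : open_in H N.
Proof.
have [n1 lead] := leading_terms.
have SJ : subset_of (@S_set p) (@Nottingham p) by move=> f [].
have NJ f : N f -> Nottingham f by move/NS => [].
(* Successive approximation: [h] is matched by elements of [N] to every depth, and [N] is closed. *)
have deep h : H h -> agree n1 h (sid p) -> N h.
  move=> Hh hn1; apply: closed_N.2 => // n.
  suff [d [Nd hd]] : exists d, N d /\ agree (n1 + n) h d.
    by exists d; split=> //; apply: agree_leq hd; lia.
  elim: n => [|n [d [Nd hd]]].
    by exists (sid p); rewrite addn0; split=> //; apply: sub_N.2.1.
  have [r [Sr dr]] := subgroup_ldiv (fun f => id) S_subgroup (NS Nd) (HS Hh).
  have [r0 _] := SJ _ Sr.
  have rn : agree (n1 + n) r (sid p).
    by apply: (agree_scomp_cancel (NJ _ Nd)) => //; rewrite dr scomp_idr.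
  rewrite addnS.
  have [Sn|nSn] := boolP ((p %| n1 + n) || (p %| (n1 + n).-1))%N.
    have [z [Nz zn zr]] := lead _ (r (n1 + n)%N) (leq_addr _ _) Sn.
    exists (scomp d z); split; first exact: sub_N.2.2.1.
    rewrite -dr; apply: agree_scomp => //; first by case: (NJ _ Nz).
    apply: agreeS; last by rewrite zr.
    exact: agree_trans rn (agree_sym zn).
  (* At an inadmissible exponent the quotient [r], being in S, has coefficient 0, so [d] needs no
     correction. *)
  exists d; split=> //; rewrite -dr -{2}[d]scomp_idr; apply: agree_scomp => //.
  apply: agreeS => //; case: (n1 + n)%N nSn => [|[|i]] nSn.
  - by rewrite dvdn0 in nSn.
  - by rewrite dvdn0 orbT in nSn.
  - by rewrite Sr.2.
split=> [|x Nx]; first exact: NH.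
exists n1 => y Hy xy; have [r [Hr xr]] := subgroup_ldiv SJ sub_H (NH Nx) Hy.
have [r0 _] := HJ Hr.
rewrite -xr; apply: sub_N.2.2.1 => //; apply: deep => //.
apply: (agree_scomp_cancel (NJ _ Nx)) => //; rewrite xr scomp_idr.
exact: agree_sym.
Qed.

End JustInfinite.

(** * Closedness, infinitude and indices of open subgroups of S *)

Section Index.
Variable p : nat.
Hypothesis p_prime : prime p.
Implicit Types (f g h x y : series p).

Let p_gt1 : (1 < p)%N := prime_gt1 p_prime.
Let p_gt0 : (0 < p)%N := prime_gt0 p_prime.
Let SJ : subset_of (@S_set p) (@Nottingham p). Proof. by move=> f []. Qed.

Lemma S_closed : closed_in (@Nottingham p) (@S_set p).
Proof.
split=> // f Nf lim; split=> // i i1 ni.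
by have [g [[_ gS] fg]] := lim i.+1; rewrite fg // gS.
Qed.

(** Diagonal argument: the coefficient of t^(p(i+1)) is that of [r i] plus 1. The shift by one keeps
    the constant term 0. *)
Lemma S_infinite : infinite_set (@S_set p).
Proof.
move=> m r.
pose a : {poly 'F_p} := \poly_(i < m.+1)
  (if i is j.+1 then
     odflt 0 (omap (fun k : 'I_m => r k (p * j.+1)%N + 1) (insub j)) else 0).
exists (poly_series (emb a 1)); split.
  by apply: S_poly_series; rewrite ?coef_poly ?coef1.
move=> i /(congr1 (fun f => f (p * i.+1)%N)).
rewrite /poly_series coef_emb0 // coef_poly ltnS ltn_ord insubT //= => lt_im /eqP.
rewrite (_ : Sub _ _ = i); last exact: val_inj.
by rewrite -subr_eq0 addrAC subrr add0r oner_eq0.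
Qed.

Variable N : series p -> Prop.
Hypothesis sub_N : subgroup (@S_set p) N.
Hypothesis open_N : open_in (@S_set p) N.

Let NS f : N f -> S_set f. Proof. exact: sub_N.1. Qed.
Let NJ : subset_of N (@Nottingham p). Proof. by move=> f /NS []. Qed.

(** Representatives for the cosets of [N] that meet the depth-n subgroup of S. A general finite type
    allows products as index sets. *)
Definition transversal_of (n : nat) (T : finType) (r : T -> series p) :=
  [/\ forall i, S_set (r i) /\ agree n (r i) (sid p),
      forall i j, in_coset N (r i) (r j) -> i = j &
      forall h, S_set h -> agree n h (sid p) -> exists i, in_coset N (r i) h].

(** The k-th power of [f] has leading coefficient k f_n, and f_n generates F_p additively. *)
Lemma leading_multiples n f c : (1 < n)%N -> N f -> agree n f (sid p) -> f n != 0 ->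
  exists g, [/\ N g, agree n g (sid p) & g n = c].
Proof.
move=> n1 Nf fn fn0.
have pow k : exists g, [/\ N g, agree n g (sid p) & g n = k%:R * f n].
  elim: k => [|k [g [Ng gn gE]]].
    exists (sid p); split=> //; first exact: sub_N.2.1.
    by rewrite /sid gtn_eqF // mul0r.
  have [f0 _] := NJ Nf.
  exists (scomp g f); split; first exact: sub_N.2.2.1.
    exact: agree_sid_scomp.
  by rewrite scomp_lead // ?gE; [rewrite -natr1; ring | apply: NJ].
have [g [Ng gn gE]] := pow (c / f n : 'F_p); exists g; split=> //.
by rewrite gE natr_Zp mulfVK.
Qed.

(* Going up from the filtration step [n + 1] to [n], the number of cosets of
   [N] is multiplied by 1 or [p], according to whether [N] has an element of
   depth exactly [n]. *)
Lemma transversal_step n e : (1 < n)%N ->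
  (exists (T : finType) (r : T -> series p), #|T| = (p ^ e)%N /\ transversal_of n.+1 r) ->
  exists e' (T : finType) (r : T -> series p),
    #|T| = (p ^ e')%N /\ transversal_of n r.
Proof.
move=> n1 [T [r [cT [rS r_inj r_cov]]]].
have rn i : agree n (r i) (sid p) by apply: agree_leq (rS i).2.
have sn : sid p n = 0 by rewrite /sid gtn_eqF.
(* At an inadmissible exponent the two filtration steps coincide. *)
have [Sn|nSn] := boolP ((p %| n) || (p %| n.-1))%N; last first.
  exists e, T, r; split=> //; split=> // [i|h Sh hn]; first by split; [case: (rS i)|].
  apply: r_cov => //; apply: agreeS => //; rewrite sn; exact: Sh.2.
have [[g [Ng gn gn0]]|noN] :=
  classic (exists g, [/\ N g, agree n g (sid p) & g n != 0]).
  exists e, T, r; split=> //; split=> // [i|h Sh hn]; first by split; [case: (rS i)|].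
  (* Dividing [h] by an element of [N] with the same leading coefficient brings it to depth n + 1,
     so the old representatives suffice. *)
  have [z [Nz zn zE]] := leading_multiples (h n) n1 Ng gn gn0.
  have [s [Ss sz]] := subgroup_rdiv (fun f => id) (S_subgroup p_prime) (NS Nz) Sh.
  have [z0 _] := NJ Nz.
  have [z' [Nz' zz' _]] := subgroup_inv SJ sub_N Nz.
  have [z'0 _] := NJ Nz'.
  have sE : s = scomp h z' by rewrite -sz scompA // zz' scomp_idr.
  have z'n : agree n z' (sid p).
    apply: (agree_scomp_cancel (NJ Nz)) => //; rewrite zz' scomp_idr.
    exact: agree_sym.
  have sn' : agree n s (sid p) by rewrite sE; apply: agree_sid_scomp.
  have [|i [x [Nx xE]]] := r_cov s Ss.
    apply: agreeS => //; have := scomp_lead n1 (SJ Ss) zn.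
    by rewrite sz zE sn -{1}[h n]add0r => /addIr.
  exists i, (scomp x z); split; first exact: sub_N.2.2.1.
  have [x0 _] := NJ Nx.
  by rewrite -scompA // xE.
(* Otherwise the series t + c t^n separate p new classes over each old one. *)
pose m (c : 'F_p) : series p := fun i => if i == n then c else sid p i.
have mP c : [/\ S_set (m c), agree n (m c) (sid p) & m c n = c].
  have mn : agree n (m c) (sid p) by move=> i lt_in; rewrite /m ltn_eqF.
  split=> //; last by rewrite /m eqxx.
  split; first exact: agree_sid_Nottingham n1 mn.
  move=> i i1 ni; rewrite /m; case: eqP => [Ei|_]; last by rewrite /sid gtn_eqF.
  by rewrite Ei Sn in ni.
have mr0 (i : T) : r i 0%N = 0 by case: (rS i) => [[[]]].
exists e.+1, ('F_p * T)%type, (fun ci => scomp (m ci.1) (r ci.2)); split.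
  by rewrite card_prod cT card_Fp // expnS.
split=> [[c i]|[c i] [d j] /= [x [Nx xE]]|h Sh hn] /=.
- have [Sm mn _] := mP c; have [Sr _] := rS i; split; first exact: S_scomp.
  exact: agree_sid_scomp.
- have [x0 _] := NJ Nx.
  have [Smc mcn mcE] := mP c; have [Smd mdn mdE] := mP d.
  have rE k u : Nottingham u -> scomp u (r k) n = u n.
    by move=> Nu; rewrite scomp_lead // (rS k).2 // sn addr0.
  have mrc : agree n (scomp (m c) (r i)) (sid p) by apply: agree_sid_scomp.
  have mrd : agree n (scomp (m d) (r j)) (sid p) by apply: agree_sid_scomp.
  have xn : agree n x (sid p).
    apply: (agree_scomp_cancel (Nottingham_scomp (SJ Smc) (SJ (rS i).1))) => //.
    rewrite xE scomp_idr; exact: agree_trans mrd (agree_sym mrc).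
  (* An element of [N] joining the two representatives has coefficient d - c at n, which is 0 since
     [N] has no element of depth exactly n. *)
  have cd : c = d.
    have := scomp_lead n1 (Nottingham_scomp (SJ Smc) (SJ (rS i).1)) xn.
    rewrite xE !rE; [rewrite mcE mdE => dE|exact: SJ..].
    have [x_n|x_n] := eqVneq (x n) 0; first by rewrite dE x_n addr0.
    by case: noN; exists x.
  subst d; congr (_, _); apply: r_inj; exists x; split=> //.
  rewrite scompA // in xE.
  by apply: scomp_cancel xE; rewrite ?scomp0 //; apply: SJ.
have [Smc mcn mcE] := mP (h n).
have [s [Ss sE]] := subgroup_ldiv (fun f => id) (S_subgroup p_prime) Smc Sh.
have [s0 _] := SJ Ss.
have s_n : agree n s (sid p).
  apply: (agree_scomp_cancel (SJ Smc)) => //; rewrite sE scomp_idr.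
  exact: agree_trans hn (agree_sym mcn).
have [|i [x [Nx xE]]] := r_cov s Ss.
  apply: agreeS => //; have := scomp_lead n1 (SJ Smc) s_n.
  by rewrite sE mcE sn -{1}[h n]addr0 => /addrI.
have [x0 _] := NJ Nx.
by exists (h n, i), x; split=> //=; rewrite scompA // xE.
Qed.

Lemma open_index : exists e, index_is (@S_set p) N (p ^ e)%N.
Proof.
have [n0 Nn0] : exists n0, forall f, S_set f -> agree n0 f (sid p) -> N f.
  have [n0 Nn0] := open_N.2 _ sub_N.2.1.
  by exists n0 => f Sf fn; apply: Nn0 => //; apply: agree_sym.
(* At this depth everything lies in [N], so there is one coset; the offset 2 keeps n > 1 in every
   descent step. *)
have start : exists e (T : finType) (r : T -> series p),
    #|T| = (p ^ e)%N /\ transversal_of n0.+2 r.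
  exists 0%N, unit, (fun=> sid p); split; first by rewrite card_unit expn0.
  split=> [_|[] []//|h Sh hn]; first by split; first exact: S_sid.
  exists tt, h; split; last by rewrite scomp_idl //; case: (SJ Sh).
  by apply: Nn0 => //; apply: agree_leq hn; lia.
(* The descent ends at depth 2, which is all of S. *)
have [e [T [r [cT [rS r_inj r_cov]]]]] : exists e (T : finType) (r : T -> series p),
    #|T| = (p ^ e)%N /\ transversal_of 2 r.
  elim: n0 start {Nn0} => // n IH [e Tr]; apply: IH.
  by apply: (@transversal_step n.+2 e).
exists e, (fun i => r (enum_val (cast_ord (esym cT) i))); split=> [i|].
  by case: (rS (enum_val (cast_ord (esym cT) i))).
split=> [i j /r_inj/enum_val_inj/cast_ord_inj //|h Sh].
have [i hi] := r_cov h Sh (Nottingham_agree2 (SJ Sh)).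
by exists (cast_ord cT (enum_rank i)); rewrite cast_ordK enum_rankK.
Qed.

End Index.

(** * An element of S of finite order *)

Section Torsion.
Variable p : nat.
Hypothesis p_prime : prime p.
Implicit Types (f g h x y : series p) (u v w : {poly 'F_p}).

Let p_gt1 : (1 < p)%N := prime_gt1 p_prime.
Let p_gt0 : (0 < p)%N := prime_gt0 p_prime.

(* Division-free form of [f^(1-p) = t^(1-p) + c]; composition of solutions
   adds the parameters. *)
Definition torsion_eqn c f := forall n u, approx n f u ->
  'X^n %| u ^+ p * (1 + c%:P * 'X^(p.-1)) - 'X^(p.-1) * u.

(* The same equation read off coefficientwise, using [f(t)^p = f(t^p)]. *)
Definition torsion_rec (c : 'F_p) n f :=
  (if (p %| n.-1)%N then f (n.-1 %/ p).+1%N else 0)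
  + c * (if (p %| n)%N then f (n %/ p)%N else 0).

Lemma torsion_rec_ext c n f g : (1 < n)%N -> agree n f g ->
  torsion_rec c n f = torsion_rec c n g.
Proof.
move=> n1 fg; rewrite /torsion_rec !fg //.
  by rewrite ltn_Pdiv // ltnW.
by case: n n1 {fg} => // n n1; rewrite ltnS ltn_Pdiv.
Qed.

Lemma torsion_coef c u n : u`_0 = 0 ->
  (u ^+ p * (1 + c%:P * 'X^(p.-1)))`_(n + p.-1) =
  (if (p %| n + p.-1)%N then u`_((n + p.-1) %/ p)%N else 0)
  + c * (if (p %| n)%N then u`_(n %/ p)%N else 0).
Proof.
move=> u0; rewrite poly_frobenius // mulrDr mulr1 mulrCA coefD coefCM coefMXn.
by rewrite ltnNge leq_addl /= addnK !coef_comp_poly_Xn.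
Qed.

Lemma pred_index n : (1 < n)%N ->
  ((p %| n + p.-1) = (p %| n.-1))%N /\ ((n + p.-1) %/ p = (n.-1 %/ p).+1)%N.
Proof.
move=> n1; have -> : (n + p.-1 = n.-1 + p)%N by lia.
by rewrite dvdn_addl // divnDr // divnn p_gt0 addn1.
Qed.

(** For n > 1, coefficient n + p - 1 of the equation is the recursion at n; all lower coefficients
    agree automatically. *)
Lemma torsion_eqnP c f : Nottingham f ->
  (torsion_eqn c f <-> forall n, (1 < n)%N -> f n = torsion_rec c n f).
Proof.
move=> [f0 f1]; split=> [eqn n n1|frec n u fu].
  have fn := @approx_trunc _ (n + p).+1 f; have := eqn _ _ fn.
  have u0 : (trunc (n + p).+1 f)`_0 = 0 by rewrite -fn.
  have lt_n : (n + p.-1 < (n + p).+1)%N by rewrite ltnS leq_add2l leq_pred.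
  move/dvdXnP/(_ _ lt_n)/eqP.
  rewrite coefB torsion_coef // coefXnM ltnNge leq_addl /= addnK subr_eq0 => /eqP.
  have [-> ->] := pred_index n1.
  have le_n2 : ((n.-1 %/ p).+1 <= n)%N.
    by case: n n1 {fn u0 lt_n} => // n n1 /=; rewrite ltnS leq_div.
  have lt_n2 : ((n.-1 %/ p).+1 < (n + p).+1)%N.
    by rewrite ltnS (leq_trans le_n2) // leq_addr.
  have lt_n1 : (n %/ p < (n + p).+1)%N.
    by rewrite ltnS (leq_trans (leq_div _ _)) // leq_addr.
  have lt_n0 : (n < (n + p).+1)%N by rewrite ltnS leq_addr.
  by rewrite /torsion_rec -!fn.
case: n fu => [|n] fu; first by rewrite dvd1p.
have u0 : u`_0 = 0 by rewrite -fu.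
apply/dvdXnP => i lt_in; apply/eqP; rewrite coefB subr_eq0; apply/eqP.
have [lt_ip|le_pi] := ltnP i p.-1.
  rewrite coefXnM lt_ip poly_frobenius // mulrDr mulr1 mulrCA coefD coefCM coefMXn.
  rewrite lt_ip mulr0 addr0 coef_comp_poly_Xn //; case: ifP => // pi.
  rewrite divn_small ?u0 //; lia.
rewrite -(subnK le_pi) torsion_coef // coefXnM ltnNge leq_addl /= addnK.
have {le_pi} : (i = i - p.-1 + p.-1)%N by rewrite subnK.
move: (i - p.-1)%N => j Ei; subst i.
case: j lt_in => [|[|j]] lt_in.
- rewrite add0n dvdn0 div0n u0 mulr0 addr0.
  by rewrite gtnNdvd ?if_same // ?ltn_predL //; lia.
- have -> : (1 + p.-1 = p)%N by lia.
  by rewrite dvdnn divnn p_gt0 /= dvdn1 gtn_eqF // mulr0 addr0.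
have [-> ->] := @pred_index j.+2 isT.
have lt_j0 : (j.+2 < n.+1)%N by apply: leq_ltn_trans lt_in; rewrite leq_addr.
have lt_j1 : (j.+2 %/ p < n.+1)%N by apply: leq_ltn_trans lt_j0; rewrite leq_div.
have lt_j2 : ((j.+2.-1 %/ p).+1 < n.+1)%N.
  by apply: leq_ltn_trans lt_j0; rewrite /= ltnS leq_div.
by rewrite -!fu // [RHS]frec.
Qed.

Lemma torsion_eqn_unique c f g : Nottingham f -> Nottingham g ->
  torsion_eqn c f -> torsion_eqn c g -> f = g.
Proof.
move=> Nf Ng /(torsion_eqnP _ Nf) fr /(torsion_eqnP _ Ng) gr.
apply: functional_extensionality; elim/ltn_ind => n IH.
have [n1|n1] := leqP n 1.
  case: Nf Ng => [f0 f1] [g0 g1].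
  by case: n n1 {IH} => [|[|]] //; rewrite ?f0 ?f1 ?g0 ?g1.
by rewrite fr // gr //; apply: torsion_rec_ext.
Qed.

(** Substituting g gives (f o g)^(1-p) = g^(1-p) + c = t^(1-p) + d + c; the proof clears
    denominators. *)
Lemma torsion_eqn_scomp c d f g : Nottingham f -> Nottingham g ->
  torsion_eqn c f -> torsion_eqn d g -> torsion_eqn (c + d) (scomp f g).
Proof.
move=> Nf Ng fc gd n w fgw; have [f0 _] := Nf; have [g0 _] := Ng.
have [fu gv] := (@approx_trunc _ n.+2 f, @approx_trunc _ n.+2 g).
move: (trunc n.+2 f) (trunc n.+2 g) fu gv => u v fu gv.
have Xv : 'X %| v by apply: approx_dvdX gv.
have := fc _ _ fu; move/(dvdXn_comp)/(_ Xv).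
have := gd _ _ gv.
set W := (u \Po v); set Y := 'X^(p.-1).
have uW : (u ^+ p \Po v) = W ^+ p by rewrite rmorphXn.
rewrite comp_polyB !comp_polyM comp_polyD comp_polyM !comp_polyC uW.
rewrite /Y comp_Xn_poly -/W -/Y => ev eu.
(* [Q] is the equation of [g] divided by [v]. The division costs one order, hence the spare
   precision in the truncations. *)
pose Q := v ^+ p.-1 * (1 + d%:P * Y) - Y.
have Qn : 'X^(n.+1) %| Q.
  have /dvdpP [z vz] : 'X^2 %| v - 'X by apply: approx_Nottingham gv.
  have vE : v = 'X * (1 + 'X * z).
    by rewrite -[v](subrK 'X) vz; ring.
  rewrite -(@Gauss_dvdpr _ _ (1 + 'X * z)); last first.
    by apply: dvdX_sub1_coprime; rewrite addrAC subrr add0r dvdp_mulr.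
  rewrite -(@dvdp_mul2l _ 'X) ?polyX_eq0 // mulrA -vE -exprS.
  have vp : v ^+ p = v * v ^+ p.-1 by rewrite -exprS prednK.
  by move: ev; congr (_ %| _); rewrite vp /Q; ring.
have WE : 'X^n %| W ^+ p * (1 + (c + d)%:P * Y) - Y * W.
  have -> : W ^+ p * (1 + (c + d)%:P * Y) - Y * W =
    (1 + d%:P * Y) * (W ^+ p * (1 + c%:P * v ^+ p.-1) - v ^+ p.-1 * W)
    + (W - c%:P * W ^+ p) * Q by rewrite /Q polyCD; ring.
  by apply: dvdp_comb; [apply: dvdXn_leq eu; lia | apply: dvdXn_leq Qn].
have wW : 'X^n %| w - W.
  apply: approx_dvd fgw _; apply: approx_leq (scomp_approx g0 fu gv); lia.
have -> : w ^+ p * (1 + (c + d)%:P * Y) - Y * w =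
  (1 + (c + d)%:P * Y) * (w ^+ p - W ^+ p)
  + 1 * ((W ^+ p * (1 + (c + d)%:P * Y) - Y * W) - Y * (w - W)) by ring.
apply: dvdp_comb; first by rewrite subrXX dvdp_mulr.
by apply: dvdp_sub => //; apply: dvdp_mull.
Qed.

Lemma S_torsion : exists f : series p, S_set f /\ f <> sid p /\
  exists m, (0 < m)%N /\ iter m (scomp f) (sid p) = sid p.
Proof.
have [|f fE] := @causal_fixpoint _ (0 : 'F_p) (fun n g =>
  if (n <= 1)%N then n%:R else torsion_rec 1 n g).
  by move=> n f g fg; case: leqP => // n1; apply: torsion_rec_ext.
have f0 : f 0%N = 0 by rewrite fE.
have f1 : f 1%N = 1 by rewrite fE.
have Nf : @Nottingham p f by [].
have fr n : (1 < n)%N -> f n = torsion_rec 1 n f by move=> n1; rewrite {1}fE leqNgt n1.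
exists f; split.
  split=> // i i1; rewrite negb_or => /andP [/negbTE ni /negbTE ni1].
  by rewrite fr // /torsion_rec ni ni1 mulr0 addr0.
split.
  (* The recursion gives coefficient 1 at t^p. *)
  move/(congr1 (fun f => f p)); rewrite fr // /torsion_rec dvdnn divnn p_gt0 f1.
  rewrite gtnNdvd ?ltn_predL //; last by lia.
  by rewrite /sid gtn_eqF // mulr1 add0r => /eqP; rewrite oner_eq0.
(* The p-th iterate has parameter p = 0, like t itself, and solutions are unique. *)
exists p; split=> //.
have f_eqn : torsion_eqn 1 f by apply/torsion_eqnP.
have id_eqn : torsion_eqn 0 (sid p).
  apply/torsion_eqnP => // n n1; rewrite /torsion_rec mul0r addr0 /sid gtn_eqF //.
  case: ifP => // pn; rewrite eqSS gtn_eqF // divn_gt0 // dvdn_leq //; lia.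
have it m : Nottingham (iter m (scomp f) (sid p)) /\
    torsion_eqn m%:R (iter m (scomp f) (sid p)).
  elim: m => [|m [Nm em]] //=; split; first exact: Nottingham_scomp.
  by rewrite -nat1r; apply: torsion_eqn_scomp.
have [Np ep] := it p.
apply: (@torsion_eqn_unique 0) => //; move: ep.
by rewrite (_ : p%:R = 0 :> 'F_p) //; apply: pcharf0; apply: pchar_Fp.
Qed.

End Torsion.

Theorem theorem6p3 (p : nat) (hp : prime p) :
  pro_p_subgroup (@S_set p) /\ hereditarily_just_infinite (@S_set p) /\
  (exists f, S_set f /\ f <> sid p /\
     exists m, (0 < m)%N /\ iter m (scomp f) (sid p) = sid p).
Proof.
split.
  split; first exact: S_subgroup.
  split; first exact: S_closed.
  by move=> N [sub_N _] open_N; apply: open_index.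
split; last exact: S_torsion.
split; first exact: S_infinite.
by move=> H sub_H open_H N normal_N closed_N nontriv; apply: closed_normal_open.
Qed.
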